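(* Let $n\geq 3$. The pure Artin braid group $P_n$ on $n$ strings has the $R_\infty$ property, i.e. $R(\alpha)=\infty$ for every automorphism $\alpha\in\operatorname{Aut}(P_n)$.
   Context: The Artin braid group $B_n$ is the group generated by $\sigma_1,\ldots,\sigma_{n-1}$ subject to the relations $\sigma_i\sigma_j=\sigma_j\sigma_i$ for $|i-j|\geq 2$ and $\sigma_{i+1}\sigma_i\sigma_{i+1}=\sigma_i\sigma_{i+1}\sigma_i$ for $1\leq i\leq n-2$. The pure Artin braid group $P_n$ is the kernel of the surjective homomorphism $B_n\to S_n$ sending $\sigma_i$ to the transposition $(i,i+1)$. For an endomorphism $\alpha$ of a group $G$, two elements $x,y\in G$ are twisted conjugate (via $\alpha$) if there is $z\in G$ with $x=zy\alpha(z)^{-1}$. This is an equivalence relation, and the number of its equivalence classes (a positive integer or $\infty$) is the Reidemeister number $R(\alpha)$. A group $G$ has the $R_\infty$ property if $R(\alpha)=\infty$ for all $\alpha\in\operatorname{Aut}(G)$. *)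

(* Defs.v *)
From HB Require Import structures.
From mathcomp Require Import all_boot all_fingroup zify.
From mathcomp Require Import generic_quotient.
From mathcomp Require Import boolp classical_sets functions cardinality.
From mathcomp Require Import finmap constructive_ereal.

Set Implicit Arguments.
Unset Strict Implicit.
Unset Printing Implicit Defensive.

Local Open Scope classical_set_scope.
Local Open Scope quotient_scope.
Local Open Scope group_scope.

(* (s, false) stands for the generator s and (s, true) for its formal inverse. *)
Definition word (S : Type) := seq (S * bool).

Definition word_gen (S : Type) (s : S) : word S := [:: (s, false)].

Definition inv_letter (S : Type) (l : S * bool) : S * bool := (l.1, ~~ l.2).

Definition word_inv (S : Type) (w : word S) : word S :=
  rev [seq inv_letter l | l <- w].

Definition word_eval (S : Type) (G : groupType) (f : S -> G) (w : word S) : G :=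
  \prod_(l <- w) (if l.2 then (f l.1)^-1 else f l.1).

(* The least congruence on words containing R and making inv_letter l an
   inverse of l; its classes are the elements of the group < S | R >. *)
Inductive word_cong (S : Type) (R : word S -> word S -> Prop) :
    word S -> word S -> Prop :=
| word_cong_rel u v of R u v : word_cong R u v
| word_cong_cancel l : word_cong R [:: l; inv_letter l] [::]
| word_cong_refl u : word_cong R u u
| word_cong_sym u v of word_cong R u v : word_cong R v u
| word_cong_trans u v w of word_cong R u v & word_cong R v w : word_cong R u w
| word_cong_cat u u' v v' of word_cong R u u' & word_cong R v v' :
    word_cong R (u ++ v) (u' ++ v').

Section PresentedGroup.
Variables (S : choiceType) (R : word S -> word S -> Prop).

Definition word_eqv : rel (word S) := fun u v => `[< word_cong R u v >].

Lemma word_eqv_equiv : equiv_class_of word_eqv.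
Proof.
split.
- by move=> u; apply/asboolP/word_cong_refl.
- by move=> u v; apply/asboolP/asboolP => /word_cong_sym.
- move=> v u w /asboolP uv /asboolP vw; apply/asboolP.
  exact: word_cong_trans uv vw.
Qed.

Canonical word_eqv_equiv_rel := EquivRelPack word_eqv_equiv.

Definition presented := {eq_quot word_eqv}.

HB.instance Definition _ := Choice.on presented.

Definition pres_class (w : word S) : presented := \pi_presented w.

Definition pres_gen (s : S) : presented := pres_class (word_gen s).

Lemma pres_classP u v : word_cong R u v <-> pres_class u = pres_class v.
Proof.
by split=> [uv|/eqmodP/asboolP //]; apply/eqmodP/asboolP.
Qed.

Lemma word_cong_repr w : word_cong R (repr (pres_class w)) w.
Proof. by apply/pres_classP; rewrite /pres_class reprK. Qed.

Definition pres_one : presented := pres_class [::].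
Definition pres_mul (x y : presented) := pres_class (repr x ++ repr y).
Definition pres_inv (x : presented) := pres_class (word_inv (repr x)).

Lemma pres_classM u v : pres_class (u ++ v) = pres_mul (pres_class u) (pres_class v).
Proof.
by apply/pres_classP/word_cong_cat; apply/word_cong_sym/word_cong_repr.
Qed.

Lemma pres_classK x : pres_class (repr x) = x.
Proof. exact: reprK. Qed.

Lemma word_inv_letterK (l : S * bool) : inv_letter (inv_letter l) = l.
Proof. by case: l => s b; rewrite /inv_letter /= negbK. Qed.

Lemma word_invK : involutive (@word_inv S).
Proof.
move=> w; rewrite /word_inv map_rev revK -map_comp.
by rewrite map_id_in // => l _; apply: word_inv_letterK.
Qed.

Lemma word_cong_catV w : word_cong R (w ++ word_inv w) [::].
Proof.
elim: w => [|l w IHw]; first exact: word_cong_refl.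
rewrite /word_inv /= rev_cons -/(word_inv w) -cats1 catA.
apply: word_cong_trans (word_cong_cancel R l).
apply: (@word_cong_cat _ _ [:: l] [:: l]); first exact: word_cong_refl.
rewrite -[X in word_cong R _ X]cat0s.
by apply: word_cong_cat => //; apply: word_cong_refl.
Qed.

Lemma word_cong_Vcat w : word_cong R (word_inv w ++ w) [::].
Proof. by rewrite -{2}(word_invK w); apply: word_cong_catV. Qed.

Lemma pres_mulA : associative pres_mul.
Proof.
move=> x y z; rewrite -[x]pres_classK -[y]pres_classK -[z]pres_classK.
by rewrite -!pres_classM catA.
Qed.

Lemma pres_mul1 : left_id pres_one pres_mul.
Proof. by move=> x; rewrite -[x]pres_classK -pres_classM. Qed.

Lemma pres_mulr1 : right_id pres_one pres_mul.
Proof. by move=> x; rewrite -[x]pres_classK -pres_classM cats0. Qed.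

Lemma pres_mulV : left_inverse pres_one pres_inv pres_mul.
Proof.
move=> x; rewrite -{2}[x]pres_classK -pres_classM.
exact/pres_classP/word_cong_Vcat.
Qed.

Lemma pres_mulrV : right_inverse pres_one pres_inv pres_mul.
Proof.
move=> x; rewrite -{1}[x]pres_classK -pres_classM.
exact/pres_classP/word_cong_catV.
Qed.

HB.instance Definition _ := isGroup.Build presented
  pres_mulA pres_mul1 pres_mulr1 pres_mulV pres_mulrV.

Section Lift.
Variables (G : groupType) (f : S -> G).
Hypothesis fR : forall u v, R u v -> word_eval f u = word_eval f v.

Lemma word_eval_cat u v :
  word_eval f (u ++ v) = word_eval f u * word_eval f v.
Proof. by rewrite /word_eval big_cat. Qed.

Lemma word_eval_cong u v : word_cong R u v -> word_eval f u = word_eval f v.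
Proof.
elim=> {u v} [u v /fR //|[s b]|//|//|u v w _ -> _ -> //|u u' v v' _ eu _ ev].
  rewrite /word_eval !big_cons big_nil /= mulg1.
  by case: b; rewrite /= ?mulgV ?mulVg.
by rewrite !word_eval_cat eu ev.
Qed.

Definition pres_lift (x : presented) : G := word_eval f (repr x).

Lemma pres_lift_class w : pres_lift (pres_class w) = word_eval f w.
Proof. exact/word_eval_cong/word_cong_repr. Qed.

Lemma pres_lift_gen s : pres_lift (pres_gen s) = f s.
Proof. by rewrite pres_lift_class /word_eval big_seq1. Qed.

Lemma pres_lift_morphism : monoid_morphism pres_lift.
Proof.
split=> [|x y]; last by rewrite [LHS]pres_lift_class word_eval_cat.
by rewrite [LHS]pres_lift_class /word_eval big_nil.
Qed.

End Lift.
End PresentedGroup.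

(* The generators sigma_1, ..., sigma_(n-1) are indexed from 0, by 'I_n.-1. *)
Inductive braid_rel (n : nat) : word 'I_n.-1 -> word 'I_n.-1 -> Prop :=
| braid_rel_comm (i j : 'I_n.-1) of (i.+2 <= j) || (j.+2 <= i) :
    braid_rel (word_gen i ++ word_gen j) (word_gen j ++ word_gen i)
| braid_rel_braid (i j : 'I_n.-1) of j = i.+1 :> nat :
    braid_rel (word_gen j ++ word_gen i ++ word_gen j)
              (word_gen i ++ word_gen j ++ word_gen i).

Definition braid (n : nat) : groupType := presented (@braid_rel n).

Definition sigma (n : nat) (i : 'I_n.-1) : braid n := pres_gen (@braid_rel n) i.

Lemma strand_subproof (n : nat) (i : 'I_n.-1) : i < n.
Proof. exact: leq_trans (ltn_ord i) (leq_pred n). Qed.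

Lemma strandS_subproof (n : nat) (i : 'I_n.-1) : i.+1 < n.
Proof. by rewrite -ltn_predRL. Qed.

Definition adjacent_tperm (n : nat) (i : 'I_n.-1) : 'S_n :=
  tperm (Ordinal (strand_subproof i)) (Ordinal (strandS_subproof i)).

Lemma adjacent_tpermE (n : nat) (i : 'I_n.-1) (k : 'I_n) :
  adjacent_tperm i k =
    (if k == i :> nat then i.+1 else if k == i.+1 :> nat then i : nat else k)
  :> nat.
Proof. by rewrite permE /= -!val_eqE /=; case: ifP => //; case: ifP. Qed.

Lemma adjacent_tperm_rel (n : nat) (u v : word 'I_n.-1) :
  braid_rel u v ->
  word_eval (@adjacent_tperm n) u = word_eval (@adjacent_tperm n) v.
Proof.
case=> i j ij; rewrite /word_eval !big_cat !big_seq1 /=; apply/permP => k;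
  apply: val_inj; rewrite !permM /= !adjacent_tpermE;
  repeat match goal with |- context [nat_of_ord ?a == ?b] =>
    case: (nat_of_ord a =P b) => ? /=
  | |- context [?a.+1 == ?b] => case: (a.+1 =P b) => ? /= end; lia.
Qed.

(* The product s * t of 'S_n applies s first; the kernel below is the same
   under either convention. *)
Definition braid_perm (n : nat) : braid n -> 'S_n :=
  pres_lift (@adjacent_tperm n).

HB.instance Definition _ (n : nat) :=
  isUMagmaMorphism.Build (braid n) 'S_n (@braid_perm n)
    (pres_lift_morphism (@adjacent_tperm_rel n)).

Lemma braid_perm_sigma (n : nat) (i : 'I_n.-1) :
  braid_perm (sigma i) = adjacent_tperm i.
Proof. exact: (pres_lift_gen (@adjacent_tperm_rel n)). Qed.

Definition pure (n : nat) : pred (braid n) := fun x => braid_perm x == 1.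

Lemma pure_closed (n : nat) : group_closed (@pure n).
Proof.
split=> [|x y]; first by rewrite unfold_in /pure gmulf1.
by rewrite !unfold_in /pure => /eqP x1 /eqP y1; rewrite gmulfF /= x1 y1 divg1.
Qed.

Record pure_braid (n : nat) := PureBraid {
  pure_val : braid n;
  pure_valP : pure pure_val
}.

HB.instance Definition _ (n : nat) := [isSub for @pure_val n].
HB.instance Definition _ (n : nat) := [Choice of pure_braid n by <:].
HB.instance Definition _ (n : nat) :=
  SubChoice_isSubGroup.Build (braid n) (@pure n) (pure_braid n)
    (@pure_closed n).

Definition twisted_conj (G : groupType) (alpha : G -> G) (x y : G) : Prop :=
  exists z : G, x = z * y * (alpha z)^-1.

Definition twisted_classes (G : groupType) (alpha : G -> G) : set (set G) :=
  [set [set x | twisted_conj alpha x y] | y in [set: G]].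

Definition reidemeister_number (G : groupType) (alpha : G -> G) : \bar nat :=
  if `[< finite_set (twisted_classes alpha) >]
  then (#|` fset_set (twisted_classes alpha)|%fset)%:E else +oo%E.

Definition has_R_infty (G : groupType) : Prop :=
  forall alpha : {multiplicative G -> G},
    bijective alpha -> reidemeister_number alpha = +oo%E.

(* Main.v *)
(* An automorphism alpha of a finitely generated group G has R(alpha) = oo as
   soon as some section gamma_k / gamma_(k+1) of the lower central series admits
   a nonzero alpha-invariant homomorphism to Q: for the least such k, any z with
   x = z y alpha(z)^-1 and x, y in gamma_k has a power in gamma_k, so the
   homomorphism separates twisted conjugacy classes.

   For P_n such a functional is found on gamma_4 / gamma_5. Let f : P_n -> F_2
   be induced by forgetting all but three strands and dividing by the centre.
   The plane in H^1(P_n) given by f o alpha^i is isotropic for the cup product;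
   the isotropic planes are classified by the values on the full twists of pairs
   of strands, and there is one for each set of three or four strands. Hence
   f o alpha^k and f o alpha^0 give the same plane for some k > 0, so they differ
   by some M in GL_2(Z) on the abelianization. As gamma_4 / gamma_5 of F_2 is
   rationally Sym^2 (x) det, it carries an invariant form, v |-> det(v, Mv). Its
   pullback, summed over the alpha-orbit, is invariant; evaluated at a commutator
   supported on the strands of one plane, the sum has a single nonzero term. *)
Require Import Defs.
From HB Require Import structures.
From mathcomp Require Import all_boot all_fingroup.
From mathcomp Require Import all_order all_algebra.
From mathcomp Require Import generic_quotient boolp classical_sets cardinality.
From mathcomp Require Import constructive_ereal.
From mathcomp Require Import zify ring.

Set Implicit Arguments.
Unset Strict Implicit.
Unset Printing Implicit Defensive.

Import GRing.Theory Num.Theory.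

Local Open Scope group_scope.

(** Weight four is the first that always works. A matrix M in GL_2(Z) acts on the first three
    rational sections of F_2 as the standard representation, as det, and as their product; for M =
    [[1, 1], [1, 0]], of determinant -1 with irrational eigenvalues, none of these has a nonzero
    invariant functional. In weight four, det(v, Mv) is multiplied by det M under M, and the factor
    det of the section turns this into (det M)^2 = 1. Isotropy enters through commuting elements:
    their images in F_2 commute, hence have parallel exponent vectors. Two kinds of pairs suffice
    for the classification: full twists on disjoint pairs of strands, and a full twist on two of
    three strands together with the full twist on all three. The functionals on F_2 come from
    homomorphisms to affine maps over truncated power series, so that their properties are
    polynomial identities. *)

Definition additive_on (G : groupType) (V : zmodType) (P : G -> Prop)
  (f : G -> V) := forall x y, P x -> P y -> f (x * y) = (f x + f y)%R.

(** * The lower central series and additive functions on its terms *)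

Section LowerCentralSeries.
Variable G : groupType.
Implicit Types (S P : G -> Prop) (x y z : G).

Inductive gspan S : G -> Prop :=
| gspan_in x of S x : gspan S x
| gspan1 : gspan S 1
| gspanM x y of gspan S x & gspan S y : gspan S (x * y)
| gspanV x of gspan S x : gspan S x^-1.

Lemma gspan_sub S S' x :
  (forall y, S y -> S' y) -> gspan S x -> gspan S' x.
Proof.
move=> sSS'; elim=> {x} [x /sSS' Sx||x y _ Sx _ Sy|x _ Sx].
- exact: gspan_in.
- exact: gspan1.
- exact: gspanM.
- exact: gspanV.
Qed.

Lemma gspanX S x n : gspan S x -> gspan S (x ^+ n).
Proof.
move=> Sx; elim: n => [|n IHn]; first by rewrite expg0; apply: gspan1.
by rewrite expgS; apply: gspanM.
Qed.

(* Indexed from 0, so that [lcs k] is the term usually numbered k + 1. *)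
Fixpoint lcs (k : nat) : G -> Prop :=
  if k is k'.+1
  then gspan (fun z => exists x y, lcs k' x /\ z = [~ x, y])
  else fun=> True.

Lemma lcs1 k : lcs k 1.
Proof. by case: k => //= k; apply: gspan1. Qed.

Lemma lcsM k x y : lcs k x -> lcs k y -> lcs k (x * y).
Proof. by case: k => //= k; apply: gspanM. Qed.

Lemma lcsV k x : lcs k x -> lcs k x^-1.
Proof. by case: k => //= k; apply: gspanV. Qed.

Lemma lcsX k x n : lcs k x -> lcs k (x ^+ n).
Proof. by case: k => //= k; apply: gspanX. Qed.

Lemma lcsR k x y : lcs k x -> lcs k.+1 [~ x, y].
Proof. by move=> kx; apply: gspan_in; exists x, y. Qed.

Lemma lcsJ k x z : lcs k x -> lcs k (x ^ z).
Proof.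
elim: k x => //= k IHk x; elim=> {x} [_ [x [y [kx ->]]]||x y _ Sx _ Sy|x _ Sx].
- by rewrite conjRg; apply: lcsR (IHk _ kx).
- by rewrite conj1g; apply: gspan1.
- by rewrite conjMg; apply: gspanM.
- by rewrite conjVg; apply: gspanV.
Qed.

Lemma lcsS k x : lcs k.+1 x -> lcs k x.
Proof.
elim=> {x} [_ [x [y [kx ->]]]||x y _ Sx _ Sy|x _ Sx].
- by apply: lcsM; [apply: lcsV | apply: lcsJ].
- exact: lcs1.
- exact: lcsM.
- exact: lcsV.
Qed.

Lemma lcs_le j k x : j <= k -> lcs k x -> lcs j x.
Proof.
move/subnK <-; elim: (k - j)%N => // m IHm; rewrite addSn => /lcsS; exact: IHm.
Qed.

Lemma lcs_ind k P :
    (forall x y, lcs k x -> P [~ x, y]) -> P 1 ->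
    (forall x y, lcs k.+1 x -> lcs k.+1 y -> P x -> P y -> P (x * y)) ->
    (forall x, lcs k.+1 x -> P x -> P x^-1) ->
  forall x, lcs k.+1 x -> P x.
Proof.
move=> PR P1 PM PV x; elim=> {x} [_ [x [y [kx ->]]]||x y Gx Sx Gy Sy|x Gx Sx].
- exact: PR.
- exact: P1.
- exact: PM.
- exact: PV.
Qed.

Section Additive.
Variables (V : zmodType) (P : G -> Prop) (f : G -> V).
Hypotheses (P1 : P 1) (PV : forall x, P x -> P x^-1).
Hypotheses (PM : forall x y, P x -> P y -> P (x * y)) (fD : additive_on P f).

Lemma additive_on1 : f 1 = 0%R.
Proof. by apply: (addrI (f 1)); rewrite -fD // mulg1 addr0. Qed.

Lemma additive_onV x : P x -> f x^-1 = (- f x)%R.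
Proof.
move=> Px; apply: (addrI (f x)); rewrite -fD //; last exact: PV.
by rewrite mulgV subrr additive_on1.
Qed.

Lemma additive_onX x n : P x -> f (x ^+ n) = (f x *+ n)%R.
Proof.
move=> Px; elim: n => [|n IHn]; first by rewrite expg0 additive_on1.
rewrite expgS fD ?IHn ?mulrS //; elim: n {IHn} => [|n IHn].
  by rewrite expg0.
by rewrite expgS; apply: PM.
Qed.

End Additive.

Section AdditiveLcs.
Variables (V : zmodType) (k : nat) (f : G -> V).
Hypothesis fD : additive_on (lcs k) f.

Lemma lcs_add1 : f 1 = 0%R.
Proof. exact: additive_on1 (lcs1 k) fD. Qed.

Lemma lcs_addV x : lcs k x -> f x^-1 = (- f x)%R.
Proof. apply: additive_onV => //; [exact: lcs1 | exact: lcsV]. Qed.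

Lemma lcs_addX x n : lcs k x -> f (x ^+ n) = (f x *+ n)%R.
Proof. apply: additive_onX => //; [exact: lcs1 | exact: lcsM]. Qed.

End AdditiveLcs.

(** Commutators generate the term, so an identity between functionals of one weight reduces to one
    commutator computation using the weight below. *)
Lemma lcs_additive_eq (V : zmodType) k (f g : G -> V) :
    additive_on (lcs k.+1) f -> additive_on (lcs k.+1) g ->
    (forall x y, lcs k x -> f [~ x, y] = g [~ x, y]) ->
  forall x, lcs k.+1 x -> f x = g x.
Proof.
move=> fD gD fg; apply: lcs_ind => [x y /fg //||x y kx ky fgx fgy|x kx fgx].
- by rewrite (lcs_add1 fD) (lcs_add1 gD).
- by rewrite fD // gD // fgx fgy.
- by rewrite (lcs_addV fD) // (lcs_addV gD) // fgx.
Qed.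

End LowerCentralSeries.

Lemma lcs_morph (G H : groupType) (f : G -> H) k x :
  {morph f : u v / u * v} -> lcs k x -> lcs k (f x).
Proof.
move=> fM.
have f1 : f 1 = 1 by apply: (mulgI (f 1)); rewrite -fM !mulg1.
have fV u : f u^-1 = (f u)^-1.
  by apply: (mulgI (f u)); rewrite -fM !mulgV.
have fR u v : f [~ u, v] = [~ f u, f v] by rewrite /commg /conjg !fM !fV.
elim: k x => //= k IHk; apply: lcs_ind => [x y kx||x y _ _|x _].
- by rewrite fR; apply/lcsR/IHk.
- by rewrite f1; apply: gspan1.
- by rewrite fM; apply: gspanM.
- by rewrite fV; apply: gspanV.
Qed.

(** * The sections of the lower central series as abelian groups *)

Section LcsSection.
Local Open Scope quotient_scope.
Variables (G : groupType) (k : nat).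
Implicit Types x y z : G.

Record lcs_term := LcsTerm { lcs_val : G; lcs_valP : `[< lcs k lcs_val >] }.
HB.instance Definition _ := [isSub for lcs_val].
HB.instance Definition _ := [Choice of lcs_term by <:].

Definition lcs_eqv : rel lcs_term :=
  fun u v => `[< lcs k.+1 (val u * (val v)^-1) >].

Lemma lcs_eqv_equiv : equiv_class_of lcs_eqv.
Proof.
split=> [u|u v|v u w].
- by apply/asboolP; rewrite mulgV; apply: lcs1.
- by apply/asboolP/asboolP => /lcsV; rewrite invgM invgK.
- move=> /asboolP uv /asboolP vw; apply/asboolP.
  by rewrite -(mulgVK (val v) (val u)) -mulgA; apply: lcsM.
Qed.

Canonical lcs_eqv_equiv_rel := EquivRelPack lcs_eqv_equiv.
Definition lcs_quo := {eq_quot lcs_eqv}.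
HB.instance Definition _ := Choice.on lcs_quo.

(** Total on [G]: an element outside [lcs k] is sent to the class of 1, so the lemmas on [lcs_pi]
    carry membership hypotheses. *)
Definition lcs_pi x : lcs_quo :=
  \pi_lcs_quo (odflt (LcsTerm (asboolT (lcs1 G k))) (insub x)).

Lemma lcs_piP x y :
  lcs k x -> lcs k y -> lcs_pi x = lcs_pi y <-> lcs k.+1 (x * y^-1).
Proof.
move=> /asboolP kx /asboolP ky; rewrite /lcs_pi !insubT /=.
by split=> [/eqmodP/asboolP //|xy]; apply/eqmodP/asboolP.
Qed.

Definition lcs_lift (a : lcs_quo) : G := val (repr a).

Lemma lcs_lift_in a : lcs k (lcs_lift a).
Proof. exact/asboolP/(valP (repr a)). Qed.

Lemma lcs_liftK a : lcs_pi (lcs_lift a) = a.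
Proof. by rewrite /lcs_pi /lcs_lift valK /= reprK. Qed.

Lemma lcs_piK x : lcs k x -> lcs k.+1 (lcs_lift (lcs_pi x) * x^-1).
Proof. by move=> kx; apply/lcs_piP/lcs_liftK=> //; apply: lcs_lift_in. Qed.

Definition lcs_zero := lcs_pi 1.
Definition lcs_add a b := lcs_pi (lcs_lift a * lcs_lift b).
Definition lcs_opp a := lcs_pi (lcs_lift a)^-1.

Lemma lcs_piM x y :
  lcs k x -> lcs k y -> lcs_pi (x * y) = lcs_add (lcs_pi x) (lcs_pi y).
Proof.
move=> kx ky; apply/esym/lcs_piP; try exact: lcsM.
  by apply: lcsM; apply: lcs_lift_in.
set x' := lcs_lift _; set y' := lcs_lift _.
rewrite (_ : _ * _^-1 = (y' * y^-1) ^ x'^-1 * (x' * x^-1)); last first.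
  by rewrite /conjg invgK invgM -!mulgA mulKg.
by apply: lcsM; [apply: lcsJ |]; apply: lcs_piK.
Qed.

Lemma lcs_piV x : lcs k x -> lcs_pi x^-1 = lcs_opp (lcs_pi x).
Proof.
move=> kx; apply/esym/lcs_piP; try exact: lcsV.
  exact/lcsV/lcs_lift_in.
rewrite invgK (_ : _ * _ = ((lcs_lift (lcs_pi x) * x^-1)^-1) ^ x); last first.
  by rewrite /conjg invgM invgK -!mulgA mulKg.
exact/lcsJ/lcsV/lcs_piK.
Qed.

Lemma lcs_addC : commutative lcs_add.
Proof.
move=> a b; have ka := lcs_lift_in a; have kb := lcs_lift_in b.
apply/lcs_piP; try exact: lcsM.
move: (lcs_lift a) (lcs_lift b) ka kb => x y kx _.
rewrite (_ : _ * _ = [~ x, y] ^ (y * x)^-1); first exact/lcsJ/lcsR.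
by rewrite /commg /conjg !gnorm.
Qed.

Lemma lcs_addA : associative lcs_add.
Proof.
move=> a b c; rewrite -[a]lcs_liftK -[b]lcs_liftK -[c]lcs_liftK.
have l := lcs_lift_in.
by rewrite -!lcs_piM ?mulgA //; apply: lcsM.
Qed.

Lemma lcs_add0 : left_id lcs_zero lcs_add.
Proof.
by move=> a; rewrite -[a]lcs_liftK -lcs_piM ?mul1g //; [exact: lcs1 | exact: lcs_lift_in].
Qed.

Lemma lcs_addN : left_inverse lcs_zero lcs_opp lcs_add.
Proof.
move=> a; have la := lcs_lift_in a; rewrite -[a]lcs_liftK -lcs_piV // -lcs_piM ?mulVg //.
exact: lcsV.
Qed.

HB.instance Definition _ :=
  GRing.isZmodule.Build lcs_quo lcs_addA lcs_addC lcs_add0 lcs_addN.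

Lemma lcs_piD : additive_on (lcs k) lcs_pi.
Proof. exact: lcs_piM. Qed.

Lemma lcs_pi_eq0 x : lcs k x -> lcs_pi x = 0%R <-> lcs k.+1 x.
Proof.
by move=> kx; rewrite (lcs_piP kx (lcs1 G k)) divg1.
Qed.

End LcsSection.

(** * Fixed points and invariant functionals on a finitely generated abelian group *)

Section IntegralRelations.
Local Open Scope ring_scope.

Lemma common_denominator r (D : 'rV[rat]_r) :
  exists N (D' : 'rV[int]_r), (0 < N)%N /\ N%:R *: D = map_mx intr D'.
Proof.
pose N := (\prod_j `|denq (D 0%R j)|)%N.
exists N, (\row_j (numq (D 0 j) * (\prod_(i | i != j) `|denq (D 0%R i)|)%N%:Z)).
split; first by rewrite prodn_gt0 // => j; rewrite absz_gt0 denq_eq0.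
apply/rowP => j; rewrite !mxE /N (bigD1 j) //= natrM rmorphM /=.
rewrite mulrAC; congr (_ * _).
have -> : (`|denq (D 0%R j)|%N)%:R = (denq (D 0%R j))%:~R :> rat.
  by rewrite -[in RHS](gez0_abs (denq_ge0 _)).
by rewrite -{2}(divq_num_den (D 0 j)) mulrCA mulfV ?mulr1 // intr_eq0 denq_eq0.
Qed.

Variables (A : zmodType) (m : nat) (e : 'I_m -> A) (beta : A -> A).
Hypothesis betaD : forall x y, beta (x + y) = beta x + beta y.

Let ev (u : 'rV[int]_m) : A := \sum_i e i *~ u 0 i.

Let evM r (D : 'rV[int]_r) (U : 'M[int]_(r, m)) :
  ev (D *m U) = \sum_j ev (row j U) *~ D 0 j.
Proof.
rewrite /ev; under eq_bigr => i _ do rewrite mxE mulrz_sumr.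
rewrite exchange_big; apply: eq_bigr => j _; rewrite mulrz_suml.
by apply: eq_bigr => i _; rewrite mxE -mulrzA mulrC.
Qed.

Let evD u w : ev (u + w) = ev u + ev w.
Proof.
by rewrite /ev -big_split; apply: eq_bigr => i _; rewrite !mxE mulrzDr.
Qed.

Let evB u w : ev (u - w) = ev u - ev w.
Proof.
by rewrite /ev -sumrB; apply: eq_bigr => i _; rewrite !mxE mulrzBr.
Qed.

Let evZ u N : ev (u *+ N) = ev u *+ N.
Proof.
rewrite /ev -sumrMnl; apply: eq_bigr => i _.
by rewrite mulmxnE; exact: (raddfMn ( *~%R (e i))).
Qed.

Let betaz x z : beta (x *~ z) = beta x *~ z.
Proof.
have beta0 : beta 0 = 0 by apply: (addrI (beta 0)); rewrite -betaD !addr0.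
have betan y n : beta (y *+ n) = beta y *+ n.
  by elim: n => [|n IHn]; rewrite ?mulr0n // !mulrS betaD IHn.
have betaN y : beta (- y) = - beta y.
  by apply: (addrI (beta y)); rewrite -betaD !subrr.
by case: z => n; rewrite ?NegzE ?mulrNz ?betaN -!pmulrn betan.
Qed.

Let ratmx r (U : 'M[int]_(r, m)) : 'M[rat]_(r, m) := map_mx intr U.

(* A maximal set of relations, up to torsion. *)
Let maximal_relations : exists r (U : 'M[int]_(r, m)),
  (forall j, ev (row j U) = 0) /\
  (forall u, ev u = 0 -> (ratmx u <= ratmx U)%MS).
Proof.
suff: forall d r (U : 'M[int]_(r, m)), (forall j, ev (row j U) = 0) ->
    (m - \rank (ratmx U) <= d)%N ->
    exists r (U : 'M[int]_(r, m)), (forall j, ev (row j U) = 0) /\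
    (forall u, ev u = 0 -> (ratmx u <= ratmx U)%MS).
  move=> /(_ m 0%N 0) []; [by case | exact: leq_subr |].
  by move=> r [U [U0 Umax]]; exists r, U.
elim=> [|d IHd] r U U0 ranku.
  exists r, U; split=> // u _; apply: submx_full.
  by rewrite /row_full eqn_leq rank_leq_col -subn_eq0 -leqn0.
have [[u [u0 uU]]|noU] :=
  pselect (exists u, ev u = 0 /\ ~~ (ratmx u <= ratmx U)%MS); last first.
  exists r, U; split=> // u u0; apply/negPn/negP => uU; apply: noU.
  by exists u.
apply: (IHd _ (col_mx U u)) => [j|].
  case: (splitP j) => k jk.
    have -> : j = lshift 1 k by apply: val_inj.
    by rewrite rowKu U0.
  have -> : j = rshift r k by apply: val_inj.
  by rewrite rowKd row_id.
have lt : (\rank (ratmx U) < \rank (ratmx (col_mx U u)))%N.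
  rewrite /ratmx map_col_mx -addsmxE; apply: rank_ltmx.
  rewrite /ltmx addsmxSl /= addsmx_sub submx_refl /=.
  exact: uU.
by move: (rank_leq_col (ratmx (col_mx U u))) ranku lt; lia.
Qed.

(** If 1 - [beta] is not onto on A (x) Q, a nonzero functional vanishing on its image is
    [beta]-invariant. If it is onto, it is injective by finite dimension, so the fixed element [a]
    vanishes in A (x) Q, that is, it is torsion. *)
Lemma fixed_torsion_or_invariant_functional (a : A) :
    (forall x, exists u : 'I_m -> int, x = \sum_i e i *~ u i) ->
    beta a = a ->
  (exists2 N, (0 < N)%N & a *+ N = 0) \/
  exists phi : A -> rat, [/\ forall x y, phi (x + y) = phi x + phi y,
    forall x, phi (beta x) = phi x & exists x, phi x != 0].
Proof.
move=> span fix_a; have [r [U [U0 Umax]]] := maximal_relations.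
have {}span x : {u : 'rV[int]_m | ev u = x}.
  apply: cid; have [u ->] := span x; exists (\row_i u i).
  by apply: eq_bigr => i _; rewrite mxE.
pose c x := sval (span x); have cK x : ev (c x) = x by apply: svalP (span x).
pose B := \matrix_i c (beta (e i)).
have evB' u : ev (u *m B) = beta (ev u).
  rewrite evM [in RHS]/ev.
  have -> : beta (\sum_i e i *~ u 0 i) = \sum_i beta (e i *~ u 0 i).
    elim/big_ind2: _ => [|x x' y y' <- <-|//]; last by rewrite betaD.
    by rewrite -(mulr0z 0) betaz mulr0z.
  by apply: eq_bigr => i _; rewrite betaz rowK cK.
pose BQ : 'M[rat]_m := map_mx intr B; pose UQ := ratmx U.
have ratmxB u : ratmx (u - u *m B) = ratmx u *m (1%:M - BQ).
  by rewrite /ratmx map_mxB map_mxM mulmxBr mulmx1.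
(* A (x) Q is Q^m modulo the rows of [UQ], so a full row space here says that 1 - [beta] is onto. *)
have [full|] := boolP (row_full (col_mx UQ (1%:M - BQ))); last first.
  move=> nfull; right.
  have: cokermx (col_mx UQ (1%:M - BQ)) != 0.
    by rewrite cokermx_eq0.
  case/matrix0Pn => i0 [j0 v0]; set C := cokermx _ in v0.
  pose v := col j0 C.
  have: col_mx UQ (1%:M - BQ) *m v = 0.
    by rewrite /v colE mulmxA mulmx_coker mul0mx.
  rewrite mul_col_mx -col_mx0 => /eq_col_mx[Uv].
  rewrite mulmxBl mul1mx => /eqP; rewrite subr_eq0 => /eqP Bv.
  have Lv u : ev u = 0 -> ratmx u *m v = 0.
    by move=> /Umax/submxP[D ->]; rewrite -mulmxA Uv mulmx0.
  have Lv2 u w : ev u = ev w -> ratmx u *m v = ratmx w *m v.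
    move=> uw; apply/eqP; rewrite -subr_eq0 -mulmxBl -map_mxB.
    by rewrite Lv // evB uw subrr.
  exists (fun x => (ratmx (c x) *m v) 0 0); split=> [x y|x|].
  - transitivity ((ratmx (c x) *m v + ratmx (c y) *m v) 0 0); last by rewrite mxE.
    rewrite -mulmxDl -map_mxD; congr (fun M : 'M_1 => M 0 0); apply: (Lv2 _ (c x + c y)).
    by rewrite evD !cK.
  - congr (fun M : 'M_1 => M 0 0); rewrite [in RHS]Bv mulmxA -map_mxM; apply: (Lv2 _ (c x *m B)).
    by rewrite evB' !cK.
  - exists (e i0).
    rewrite (Lv2 _ (delta_mx 0 i0)).
      by rewrite /ratmx map_delta_mx -rowE mxE /v mxE.
    rewrite cK /ev (bigD1 i0) //= big1 ?addr0 => [|i /negPf ii0].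
      by rewrite mxE !eqxx.
    by rewrite mxE ii0 andbF mulr0z.
left.
have nU : (ratmx (c a) <= UQ)%MS.
  (* [C] projects Q^m to A (x) Q, and [E] is 1 - [beta] followed by [C]. Comparing ranks shows that
     the kernel of [E] is no more than the row space of [UQ]. *)
  pose C := cokermx UQ; pose E := (1%:M - BQ) *m C.
  have UE : (UQ <= kermx E)%MS.
    apply/sub_kermxP; apply/row_matrixP => j; rewrite row0 /E mulmxA.
    rewrite row_mul row_mul -map_row -/(ratmx (row j U)) -ratmxB.
    apply/eqP; rewrite -submxE; apply: Umax.
    by rewrite evB evB' U0 -(mulr0z 0) betaz !mulr0z subrr.
  have rankE : (\rank (kermx E) <= \rank UQ)%N.
    have /row_fullP[X] := full.
    rewrite -[X]hsubmxK mul_row_col => /(congr1 (mulmx^~ C)).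
    rewrite /= mulmxDl -!mulmxA mulmx_coker mulmx0 add0r mul1mx -/E => XE.
    have: (\rank C <= \rank E)%N by rewrite -{1}XE mxrankM_maxr.
    rewrite mxrank_ker mxrank_coker => le.
    by have := rank_leq_col UQ; have := rank_leq_row E; lia.
  have EU : (kermx E <= UQ)%MS.
    by have [_ <-] := mxrank_leqif_sup UE; rewrite eqn_leq rankE mxrankS.
  apply: submx_trans EU; apply/sub_kermxP.
  rewrite /E mulmxA -ratmxB; apply/eqP; rewrite -submxE; apply: Umax.
  by rewrite evB evB' cK fix_a subrr.
(* The relation holds over Q; a common denominator [N] makes it an integral combination of
   relations. *)
have /submxP[D cD] := nU; have [N [D' [N0 ND]]] := common_denominator D.
exists N => //; rewrite -(cK a) -evZ.
have -> : c a *+ N = D' *m U.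
  suff: ratmx (c a *+ N) = ratmx (D' *m U).
    by move/rowP=> eq; apply/rowP => j; apply: (@intr_inj rat); have:= eq j; rewrite !mxE.
  rewrite /ratmx map_mxM -ND -scalemxAl -cD scaler_nat.
  exact: (raddfMn (map_mx intr)).
by rewrite evM big1 // => j _; rewrite U0 mul0rz.
Qed.
End IntegralRelations.

(** * Finite generation of the sections *)

Definition finitely_generated (G : groupType) :=
  exists L : seq G, forall x, gspan (fun y => y \in L) x.

Section CommutatorIdentities.
Variable G : groupType.
Implicit Types x y z : G.

Lemma commMgJ x y z : [~ x * y, z] = [~ x, z] ^ y * [~ y, z].
Proof. by rewrite /commg /conjg !gnorm. Qed.

Lemma commgMJ x y z : [~ x, y * z] = [~ x, z] * [~ x, y] ^ z.
Proof. by rewrite /commg /conjg !gnorm. Qed.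

Lemma commVgJ x y : [~ x^-1, y] = ([~ x, y]^-1) ^ x^-1.
Proof. by rewrite /commg /conjg !gnorm. Qed.

Lemma commgVJ x y : [~ x, y^-1] = ([~ x, y]^-1) ^ y^-1.
Proof. by rewrite /commg /conjg !gnorm. Qed.

Lemma conjg_commg x y : x ^ y = x * [~ x, y].
Proof. by rewrite /commg /conjg !gnorm. Qed.

End CommutatorIdentities.

Section SectionsFinitelyGenerated.
Variable G : groupType.
Hypothesis fgG : finitely_generated G.

(** Commutation is bilinear modulo the next term, so the commutators of generators of one section
    with generators of [G] generate the next section. *)
Lemma lcs_section_fin_gen k : exists E : seq G,
  (forall e, e \in E -> lcs k e) /\
  (forall x, lcs k x -> gspan (fun y => y \in E \/ lcs k.+1 y) x).
Proof.
have [L genL] := fgG.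
elim: k => [|k [E [kE genE]]].
  exists L; split=> // x _; apply: gspan_sub (genL x) => y; by left.
have Ek x : gspan (fun y => y \in E \/ lcs k.+1 y) x -> lcs k x.
  elim=> {x} [x [/kE //|/lcsS //]||x y _ kx _ ky|x _ kx].
  - exact: lcs1.
  - exact: lcsM.
  - exact: lcsV.
pose E' := [seq [~ e, g] | e <- E, g <- L]; exists E'.
have kE' e : e \in E' -> lcs k.+1 e.
  by case/allpairsP=> -[e' g] /= [/kE ke' _ ->]; apply: lcsR.
split=> //; set Q := gspan _.
have Q_in x : lcs k.+2 x -> Q x by move=> kx; apply: gspan_in; right.
have QJ x z : lcs k.+1 x -> Q x -> Q (x ^ z).
  move=> kx Qx; rewrite conjg_commg; apply: gspanM => //.
  exact/Q_in/lcsR.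
apply: lcs_ind => [x y kx||x y _ _|x _]; last first.
- exact: gspanV.
- exact: gspanM.
- exact: gspan1.
elim: {x kx}(genE x kx) => [x [xE|kx]||x1 x2 /Ek k1 IH1 /Ek k2 IH2|x /Ek kx IH].
- elim: {y}(genL y) => [y yL||y1 y2 _ IH1 _ IH2|y _ IH].
  + by apply: gspan_in; left; apply: allpairs_f.
  + by rewrite commg1; apply: gspan1.
  + by rewrite commgMJ; apply: gspanM => //; apply: QJ => //; apply/lcsR/kE.
  + rewrite commgVJ; apply: QJ; last exact: gspanV.
    exact/lcsV/lcsR/kE.
- exact/Q_in/lcsR.
- by rewrite comm1g; apply: gspan1.
- by rewrite commMgJ; apply: gspanM => //; apply: QJ => //; apply: lcsR.
- rewrite commVgJ; apply: QJ; last exact: gspanV.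
  exact/lcsV/lcsR.
Qed.
End SectionsFinitelyGenerated.

(** * A criterion for an infinite Reidemeister number *)

Section InvariantFunctional.
Variables (G : groupType) (alpha : G -> G).
Hypotheses (fgG : finitely_generated G) (alphaM : {morph alpha : x y / x * y}).

Definition invariant_functional k (phi : G -> rat) := [/\ additive_on (lcs k) phi,
  forall x, lcs k.+1 x -> phi x = 0%R, forall x, lcs k x -> phi (alpha x) = phi x &
  exists2 x, lcs k x & phi x != 0%R].

Let alpha_lcs k x : lcs k x -> lcs k (alpha x).
Proof. exact: lcs_morph. Qed.

Let phiJ k phi x z : invariant_functional k phi -> lcs k x ->
  phi (x ^ z) = phi x.
Proof.
move=> [phiD phi0 _ _] kx; have kR := lcsR z kx.
by rewrite conjg_commg phiD ?(phi0 _ kR) ?addr0 //; exact: lcsS kR.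
Qed.

Let expMr k (z t : G) n : lcs k t -> exists2 t', lcs k t' & (z * t) ^+ n = z ^+ n * t'.
Proof.
move=> kt; elim: n => [|n [t' kt' IHn]].
  by exists 1; [exact: lcs1 | rewrite !expg0 mulg1].
exists (t' ^ z * t); first by apply: lcsM => //; apply: lcsJ.
by rewrite !expgSr IHn /conjg !mulgA mulgK.
Qed.

Let alpha1 : alpha 1 = 1.
Proof. by apply: (mulgI (alpha 1)); rewrite -alphaM !mulg1. Qed.

Let alphaX x n : alpha (x ^+ n) = alpha x ^+ n.
Proof. by elim: n => [|n IHn]; rewrite ?expg0 // !expgS alphaM IHn. Qed.

(** Climbs the series: a power [w] of [z] in [lcs j] has a fixed image in section [j], because
    [w^-1 * alpha w] stays in [lcs k], inside [lcs j.+1]. Without an invariant functional at [j]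
    that image is torsion, so a further power lies in [lcs j.+1]. *)
Let fixed_power k z :
    (forall j phi, (j < k)%N -> ~ invariant_functional j phi) ->
  lcs k (z^-1 * alpha z) -> exists2 N, (0 < N)%N & lcs k (z ^+ N).
Proof.
move=> noinv kz.
suff: forall j, (j <= k)%N -> exists2 N, (0 < N)%N & lcs j (z ^+ N) by apply.
elim=> [_|j IHj jk]; first by exists 1%N.
have {IHj}[N N0 jw] := IHj (ltnW jk); set w := z ^+ N in jw.
have jw' : lcs j.+1 (w^-1 * alpha w).
  have [t' kt' eq] := expMr z N kz.
  by move: eq; rewrite mulVKg -alphaX => ->; rewrite mulKg; apply: lcs_le kt'.
pose pi := @lcs_pi G j; pose lift := @lcs_lift G j.
have piD : additive_on (lcs j) pi by exact: lcs_piD.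
have pi_eq x y : lcs j x -> lcs j y -> lcs j.+1 (x^-1 * y) -> pi x = pi y.
  move=> jx jy jxy; rewrite -[y](mulVKg x) piD //; last exact: lcsS.
  by rewrite [pi (_ * _)](lcs_pi_eq0 (lcsS jxy)).2 // addr0.
pose beta a := pi (alpha (lift a)).
have betapi x : lcs j x -> beta (pi x) = pi (alpha x).
  move=> jx; apply: pi_eq; [exact/alpha_lcs/lcs_lift_in | exact: alpha_lcs |].
  have alphaVM u v : (alpha u)^-1 * alpha v = alpha (u^-1 * v).
    by rewrite -{1}(mulVKg u v) alphaM mulKg.
  rewrite alphaVM; apply: lcs_morph => //; set l := lift _.
  rewrite (_ : _ * _ = (l * x^-1)^-1 ^ x); last by rewrite /conjg !gnorm.
  exact/lcsJ/lcsV/lcs_piK.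
have betaD a b : beta (a + b)%R = (beta a + beta b)%R.
  have [la lb] := (lcs_lift_in a, lcs_lift_in b).
  rewrite -[a](lcs_liftK) -[b](lcs_liftK) -(lcs_piD la lb).
  by rewrite !betapi ?alphaM ?piD //; [exact: alpha_lcs.. | exact: lcsM].
have [E [jE genE]] := lcs_section_fin_gen fgG j.
pose e (i : 'I_(size E)) := pi (nth 1 E i).
have spanE (a : lcs_quo G j) : exists u : 'I_(size E) -> int,
    a = (\sum_i e i *~ u i)%R.
  rewrite -[a](lcs_liftK); have := lcs_lift_in a; set x := lcs_lift a => jx.
  suff: lcs j x /\ exists u : 'I_(size E) -> int,
      pi x = (\sum_i e i *~ u i)%R by case.
  elim: {a x jx}(genE x jx) => [x [xE|jx]||x y _ [jx [u xu]] _ [jy [v yv]]|x _ [jx [u xu]]].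
  - split; first exact: jE.
    have xi : (index x E < size E)%N by rewrite index_mem.
    exists (fun i => Posz (i == Ordinal xi)); rewrite (bigD1 (Ordinal xi)) //=.
    rewrite /e nth_index // eqxx big1 ?addr0 // => i /negPf ->.
    by rewrite mulr0z.
  - split; first exact: lcsS.
    exists (fun=> 0%R); rewrite big1 => [|i _]; last by rewrite mulr0z.
    exact/(lcs_pi_eq0 (lcsS jx)).
  - split; first exact: lcs1.
    exists (fun=> 0%R); rewrite big1 => [|i _]; last by rewrite mulr0z.
    exact: lcs_add1 piD.
  - split; first exact: lcsM.
    exists (fun i => u i + v i)%R; rewrite piD // xu yv -big_split.
    by apply: eq_bigr => i _; rewrite mulrzDr.
  - split; first exact: lcsV.
    exists (fun i => - u i)%R; rewrite (lcs_addV piD) // xu -sumrN.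
    by apply: eq_bigr => i _; rewrite mulrNz.
have fixw : beta (pi w) = pi w.
  by rewrite betapi //; apply/esym/pi_eq => //; apply: alpha_lcs.
have [[M M0 wM]|[phi [phiD phib [a phia]]]] :=
    fixed_torsion_or_invariant_functional betaD spanE fixw.
  exists (N * M)%N; first by rewrite muln_gt0 N0.
  rewrite expgM; apply/lcs_pi_eq0; first exact: lcsX.
  by rewrite -/w -/pi (lcs_addX piD).
case: (noinv j (phi \o pi) jk); split=> [x y jx jy /=|x jx /=|x jx /=|].
- by rewrite piD.
- rewrite [pi x](lcs_pi_eq0 (lcsS jx)).2 //.
  by apply: (addrI (phi 0%R)); rewrite -phiD !addr0.
- by rewrite -betapi.
- by exists (lift a); [exact: lcs_lift_in | rewrite /= [pi _]lcs_liftK].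
Qed.

(** Put t = z^-1 alpha(z), in [lcs k], and let z^N be in [lcs k]. Expanding (z t)^N gives
    phi(alpha(z^N)) = phi(z^N) + N phi(t). Invariance forces phi(t) = 0, and phi(t) = phi(y) -
    phi(x). *)
Lemma invariant_functional_twisted k phi x y :
    (forall j psi, (j < k)%N -> ~ invariant_functional j psi) ->
    invariant_functional k phi -> lcs k x -> lcs k y -> twisted_conj alpha x y ->
  phi x = phi y.
Proof.
move=> noinv phi_inv kx ky [z xzy].
have alphaz : alpha z = z * ((x^-1) ^ z * y).
  by rewrite xzy /conjg !gnorm.
set t := _ * y in alphaz; have kt : lcs k t.
  by apply: lcsM => //; apply/lcsJ/lcsV.
have [N N0 kzN] : exists2 N, (0 < N)%N & lcs k (z ^+ N).
  by apply: fixed_power => //; rewrite alphaz mulKg.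
have [phiD _ phia _] := phi_inv.
have [t' kt' [zt' phit']] : exists2 t', lcs k t' &
    (z * t) ^+ N = z ^+ N * t' /\ phi t' = (phi t *+ N)%R.
  move: t kt {alphaz} => t kt.
  elim: (N) => [|n [t' kt' [IHn phit']]].
    exists 1; first exact: lcs1.
    by rewrite !expg0 mulg1 mulr0n (lcs_add1 phiD).
  exists (t' ^ z * t); first by apply: lcsM => //; apply: lcsJ.
  rewrite !expgSr IHn phiD //; last exact: lcsJ.
  rewrite (phiJ _ phi_inv) // phit' mulrSr; split=> //.
  by rewrite /conjg !mulgA mulgK.
have := phia _ kzN; rewrite alphaX alphaz zt' phiD // => /eqP.
rewrite -subr_eq0 addrC addKr phit' mulrn_eq0 -[_ == 0%N]negbK -lt0n N0 /=.
rewrite phiD //; last exact/lcsJ/lcsV.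
rewrite (phiJ _ phi_inv); last exact: lcsV.
by rewrite (lcs_addV phiD) // addrC subr_eq0 => /eqP.
Qed.

Lemma invariant_functional_Reidemeister k phi :
  invariant_functional k phi -> reidemeister_number alpha = +oo%E.
Proof.
elim/ltn_ind: k phi => k IHk phi phi_inv.
(* Reduces to the least index carrying an invariant functional, as the separation of classes
   requires. *)
have [[j [psi [jk psi_inv]]]|noinv] := pselect (exists j psi,
    (j < k)%N /\ invariant_functional j psi).
  exact: IHk psi_inv.
have {}noinv j psi : (j < k)%N -> ~ invariant_functional j psi.
  by move=> jk psi_inv; apply: noinv; exists j, psi.
have [phiD _ _ [x kx phix]] := phi_inv.
rewrite /reidemeister_number asboolF // => fin.
(* The powers of [x] already lie in distinct classes, since [phi] takes the value n phi(x) on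
   [x ^+ n]. *)
pose cls n := [set y | twisted_conj alpha y (x ^+ n)]%classic.
have cls_inj : injective cls.
  move=> m n mn; have: cls n (x ^+ m).
    by rewrite -mn; exists 1; rewrite alpha1 invg1 mulg1 mul1g.
  move/(invariant_functional_twisted noinv phi_inv (lcsX m kx) (lcsX n kx)).
  rewrite !(lcs_addX phiD) //; exact: mulrIn phix _ _.
have : finite_set (range cls).
  by apply: sub_finite_set fin => _ [n _ <-]; exists (x ^+ n).
apply: contra_not infinite_nat; apply: card_le_finite.
by rewrite (card_le_eqr (inj_card_eq (in2W cls_inj))).
Qed.

End InvariantFunctional.

Section PresentedInduction.
Variables (S : choiceType) (R : word S -> word S -> Prop).

Lemma pres_classM_group u v :
  pres_class R (u ++ v) = pres_class R u * pres_class R v.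
Proof. exact: pres_classM. Qed.

Lemma pres_class_letter (s : S) (c : bool) :
  pres_class R [:: (s, c)] = if c then (pres_gen R s)^-1 else pres_gen R s.
Proof.
case: c => //; apply: (mulgI (pres_gen R s)); rewrite mulgV.
rewrite -pres_classM_group; exact/pres_classP/(word_cong_cancel R (s, false)).
Qed.

Lemma pres_ind (P : presented R -> Prop) :
    P 1 -> (forall s x, P x -> P (pres_gen R s * x)) ->
    (forall s x, P x -> P ((pres_gen R s)^-1 * x)) ->
  forall x, P x.
Proof.
move=> P1 Pg PgV x; rewrite -[x]pres_classK; elim: (repr x) => // -[s c] w IHw.
rewrite -cat1s pres_classM_group pres_class_letter.
by case: c; [apply: PgV | apply: Pg].
Qed.

End PresentedInduction.

(** * Affine jets detecting the first four weights *)

Section Jets.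
Local Open Scope ring_scope.

(* (q, p0, p1, p2, p3) is the affine map v |-> e^(q t) v + sum_k p_k t^k / k!
   over power series in t truncated at t^4. *)
Definition jet : Type := (int * int * int * int * int)%type.

HB.instance Definition _ := Choice.copy jet (int * int * int * int * int)%type.

Definition jet_q (X : jet) : int := X.1.1.1.1.
Definition jet_p0 (X : jet) : int := X.1.1.1.2.
Definition jet_p1 (X : jet) : int := X.1.1.2.
Definition jet_p2 (X : jet) : int := X.1.2.
Definition jet_p3 (X : jet) : int := X.2.

Definition jet_one : jet := (0, 0, 0, 0, 0).
(** Composition of affine maps, [Y] first; the factors 2 and 3 are binomial coefficients from
    multiplying e^(q t) by a series in t^k / k!, a basis that keeps all entries integral. *)
Definition jet_mul (X Y : jet) : jet :=
  let: (q, a0, a1, a2, a3) := X in let: (r, b0, b1, b2, b3) := Y in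
  (q + r, a0 + b0, a1 + b1 + q * b0, a2 + b2 + 2 * q * b1 + q ^+ 2 * b0,
   a3 + b3 + 3 * q * b2 + 3 * q ^+ 2 * b1 + q ^+ 3 * b0).
Definition jet_inv (X : jet) : jet :=
  let: (q, a0, a1, a2, a3) := X in
  (- q, - a0, - a1 + q * a0, - a2 + 2 * q * a1 - q ^+ 2 * a0,
   - a3 + 3 * q * a2 - 3 * q ^+ 2 * a1 + q ^+ 3 * a0).

Lemma jet_mulA : associative jet_mul.
Proof.
case=> [[[[q a0] a1] a2] a3] [[[[r b0] b1] b2] b3] [[[[s c0] c1] c2] c3].
by rewrite /jet_mul; congr (_, _, _, _, _); ring.
Qed.

Lemma jet_mul1 : left_id jet_one jet_mul.
Proof.
case=> [[[[q a0] a1] a2] a3]; rewrite /jet_mul /jet_one.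
by congr (_, _, _, _, _); ring.
Qed.

Lemma jet_mulr1 : right_id jet_one jet_mul.
Proof.
case=> [[[[q a0] a1] a2] a3]; rewrite /jet_mul /jet_one.
by congr (_, _, _, _, _); ring.
Qed.

Lemma jet_mulV : left_inverse jet_one jet_inv jet_mul.
Proof.
case=> [[[[q a0] a1] a2] a3]; rewrite /jet_mul /jet_one /jet_inv.
by congr (_, _, _, _, _); ring.
Qed.

Lemma jet_mulrV : right_inverse jet_one jet_inv jet_mul.
Proof.
case=> [[[[q a0] a1] a2] a3]; rewrite /jet_mul /jet_one /jet_inv.
by congr (_, _, _, _, _); ring.
Qed.

HB.instance Definition _ := isGroup.Build jet
  jet_mulA jet_mul1 jet_mulr1 jet_mulV jet_mulrV.

Lemma jetM_q (X Y : jet) : jet_q (X * Y)%g = jet_q X + jet_q Y.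
Proof. by case: X => [[[[? ?] ?] ?] ?]; case: Y => [[[[? ?] ?] ?] ?]. Qed.

Lemma jetM_p0 (X Y : jet) : jet_p0 (X * Y)%g = jet_p0 X + jet_p0 Y.
Proof. by case: X => [[[[? ?] ?] ?] ?]; case: Y => [[[[? ?] ?] ?] ?]. Qed.

Lemma jetM_p1 (X Y : jet) :
  jet_p1 (X * Y)%g = jet_p1 X + jet_p1 Y + jet_q X * jet_p0 Y.
Proof. by case: X => [[[[? ?] ?] ?] ?]; case: Y => [[[[? ?] ?] ?] ?]. Qed.

Lemma jetV_q (X : jet) : jet_q (X^-1)%g = - jet_q X.
Proof. by case: X => [[[[? ?] ?] ?] ?]. Qed.

Lemma jetV_p0 (X : jet) : jet_p0 (X^-1)%g = - jet_p0 X.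
Proof. by case: X => [[[[? ?] ?] ?] ?]. Qed.

Lemma jetR_q (X Y : jet) : jet_q [~ X, Y]%g = 0.
Proof. by rewrite /commg /conjg !jetM_q !jetV_q; ring. Qed.

Lemma jetR_p0 (X Y : jet) : jet_p0 [~ X, Y]%g = 0.
Proof. by rewrite /commg /conjg !jetM_p0 !jetV_p0; ring. Qed.

Lemma jetR_p1 (X Y : jet) :
  jet_p1 [~ X, Y]%g = jet_q X * jet_p0 Y - jet_q Y * jet_p0 X.
Proof.
case: X => [[[[q a0] a1] a2] a3]; case: Y => [[[[r b0] b1] b2] b3].
rewrite /commg /conjg /= /jet_p1 /jet_q /jet_p0 /=; ring.
Qed.

Lemma jetM_q0 (X Y : jet) : jet_q X = 0 -> [/\ jet_p1 (X * Y)%g = jet_p1 X + jet_p1 Y,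
  jet_p2 (X * Y)%g = jet_p2 X + jet_p2 Y & jet_p3 (X * Y)%g = jet_p3 X + jet_p3 Y].
Proof.
case: X => [[[[q a0] a1] a2] a3]; case: Y => [[[[r b0] b1] b2] b3].
by rewrite /jet_q /= => ->; split; rewrite /jet_p1 /jet_p2 /jet_p3 /=; ring.
Qed.

(** Conjugation by [Y] turns the translation by P into the translation by e^(- q t) P, with q =
    [jet_q Y]; hence the commutator translates by (e^(- q t) - 1) P. The 2, and the 3 one weight
    higher, compare t^k / k! with t times t^(k-1) / (k-1)!. *)
Lemma jetR_p2 (X Y : jet) : jet_q X = 0 -> jet_p0 X = 0 ->
  jet_p2 [~ X, Y]%g = - 2 * jet_q Y * jet_p1 X.
Proof.
case: X => [[[[q a0] a1] a2] a3]; case: Y => [[[[r b0] b1] b2] b3].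
rewrite /jet_q /jet_p0 /= => -> ->.
rewrite /commg /conjg /= /jet_p1 /jet_p2 /=; ring.
Qed.

Lemma jetR_p3 (X Y : jet) : jet_q X = 0 -> jet_p0 X = 0 -> jet_p1 X = 0 ->
  jet_p3 [~ X, Y]%g = - 3 * jet_q Y * jet_p2 X.
Proof.
case: X => [[[[q a0] a1] a2] a3]; case: Y => [[[[r b0] b1] b2] b3].
rewrite /jet_q /jet_p0 /jet_p1 /= => -> -> ->.
rewrite /commg /conjg /= /jet_p2 /jet_p3 /=; ring.
Qed.

(** Each further commutator raises the order in t of the translation by one; truncated at t^4, the
    jets of [lcs 4] are trivial. *)
Lemma jet_lcs1 (X : jet) : lcs 1 X -> jet_q X = 0 /\ jet_p0 X = 0.
Proof.
move: X; apply: lcs_ind => [X Y _||X Y _ _ [qX pX] [qY pY]|X _ [qX pX]] //.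
- by rewrite jetR_q jetR_p0.
- by rewrite jetM_q jetM_p0 qX qY pX pY.
- by rewrite jetV_q jetV_p0 qX pX.
Qed.

Lemma jet_additive : [/\ additive_on (lcs 1) jet_p1,
  additive_on (lcs 1) jet_p2 & additive_on (lcs 1) jet_p3].
Proof.
by split=> X Y /jet_lcs1[/(jetM_q0 Y)[p1 p2 p3] _] _.
Qed.

Lemma jet_lcs2 (X : jet) : lcs 2 X -> jet_p1 X = 0.
Proof.
have [p1D _ _] := jet_additive.
have p1D2 : additive_on (lcs 2) jet_p1 by move=> x y /lcsS ? /lcsS; apply: p1D.
apply: (@lcs_additive_eq _ _ _ _ (fun=> 0)) => // Y Z.
by move=> /jet_lcs1[q0 p0]; rewrite jetR_p1 q0 p0 mul0r mulr0 subrr.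
Qed.

Lemma jet_lcs3 (X : jet) : lcs 3 X -> jet_p2 X = 0.
Proof.
have [_ p2D _] := jet_additive.
have p2D3 : additive_on (lcs 3) jet_p2.
  by move=> x y kx ky; apply: p2D; apply: (@lcs_le _ 1 3).
apply: (@lcs_additive_eq _ _ _ _ (fun=> 0)) => // Y Z kY.
have [q0 p0] := jet_lcs1 (lcsS kY).
by rewrite jetR_p2 // (jet_lcs2 kY) mulr0.
Qed.

Lemma jet_lcs4 (X : jet) : lcs 4 X -> jet_p3 X = 0.
Proof.
have [_ _ p3D] := jet_additive.
have p3D4 : additive_on (lcs 4) jet_p3.
  by move=> x y kx ky; apply: p3D; apply: (@lcs_le _ 1 4).
apply: (@lcs_additive_eq _ _ _ _ (fun=> 0)) => // Y Z kY.
have [q0 p0] := jet_lcs1 (lcs_le (isT : (1 <= 3)%N) kY).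
by rewrite jetR_p3 // ?(jet_lcs3 kY) ?(jet_lcs2 (lcsS kY)) ?mulr0.
Qed.

End Jets.

(** * Functionals on the free group of rank two *)

Section FreeGroup.
Local Open Scope ring_scope.

Definition free2 : groupType := presented (fun _ _ : word bool => False).
Definition free2_gen (c : bool) : free2 := pres_gen (fun _ _ => False) c.

Section ToJet.
Variables (X Y : jet).

Definition to_jet : free2 -> jet := pres_lift (fun c => if c then X else Y).

Lemma to_jetM : {morph to_jet : x y / (x * y)%g}.
Proof.
by case: (@pres_lift_morphism _ (fun _ _ => False) _
  (fun c : bool => if c then X else Y)).
Qed.

Lemma to_jet_gen c : to_jet (free2_gen c) = if c then X else Y.
Proof. exact: (@pres_lift_gen _ (fun _ _ => False)). Qed.

Lemma to_jet1 : to_jet 1%g = 1%g.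
Proof. by apply: (mulgI (to_jet 1%g)); rewrite -to_jetM !mulg1. Qed.

Lemma to_jetV x : to_jet (x^-1)%g = ((to_jet x)^-1)%g.
Proof. by apply: (mulgI (to_jet x)); rewrite -to_jetM !mulgV to_jet1. Qed.

Lemma to_jetR x y : to_jet [~ x, y]%g = [~ to_jet x, to_jet y]%g.
Proof. by rewrite /commg /conjg !to_jetM !to_jetV. Qed.

Lemma to_jet_lcs k x : lcs k x -> lcs k (to_jet x).
Proof. exact/lcs_morph/to_jetM. Qed.

End ToJet.

Definition jet_pair (q p : int) : jet := (q, p, 0, 0, 0).

(* (q, p0) is (a, b), (b, - a) and (a + b, b) for the exponent sums a and b. *)
Let th1 := to_jet (jet_pair 1 0) (jet_pair 0 1).
Let th2 := to_jet (jet_pair 0 (-1)) (jet_pair 1 0).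
Let th3 := to_jet (jet_pair 1 0) (jet_pair 1 1).

Definition expa (x : free2) : int := jet_q (th1 x).
Definition expb (x : free2) : int := jet_p0 (th1 x).
(** Read a word as a lattice path with coordinates ([expa], [expb]). Under [th1], the entry p_k is
    the sum of x^k dy along the path; for a closed path p_1 is the enclosed signed area and p_2
    twice its first moment in x. A quarter turn gives the moment in y, [momentb]. *)
Definition area (x : free2) : int := jet_p1 (th1 x).
Definition momenta (x : free2) : int := jet_p2 (th1 x).
Definition momentb (x : free2) : int := jet_p2 (th2 x).
(** Polarization: on a commutator [x, y] with x in [lcs 2], the three p_3 are -3 times a m_a, b m_b
    and (a + b)(m_a + m_b), for the exponents a, b of y and the moments m_a, m_b of x. The weights
    assemble the form with entries [l0], [l1], [l2]. *)
Definition quadratic (l0 l1 l2 : int) (x : free2) : int :=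
  (l0 - l1) * jet_p3 (th1 x) + (l2 - l1) * jet_p3 (th2 x) + l1 * jet_p3 (th3 x).

Lemma expaM x y : expa (x * y)%g = expa x + expa y.
Proof. by rewrite /expa /th1 to_jetM jetM_q. Qed.

Lemma expbM x y : expb (x * y)%g = expb x + expb y.
Proof. by rewrite /expb /th1 to_jetM jetM_p0. Qed.

Lemma expa_gen c : expa (free2_gen c) = c%:Z.
Proof. by rewrite /expa /th1 to_jet_gen; case: c. Qed.

Lemma expb_gen c : expb (free2_gen c) = (~~ c)%:Z.
Proof. by rewrite /expb /th1 to_jet_gen; case: c. Qed.

Lemma areaM x y : area (x * y)%g = area x + area y + expa x * expb y.
Proof. by rewrite /area /th1 to_jetM jetM_p1. Qed.

Let exponents x : [/\ jet_q (th2 x) = expb x, jet_p0 (th2 x) = - expa x,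
  jet_q (th3 x) = expa x + expb x & jet_p0 (th3 x) = expb x].
Proof.
rewrite /expa /expb /th1 /th2 /th3.
elim/pres_ind: x => [|s x [h1 h2 h3 h4]|s x [h1 h2 h3 h4]].
- by rewrite !to_jet1.
- rewrite !to_jetM !jetM_q !jetM_p0 -/(free2_gen s) !to_jet_gen h1 h2 h3 h4.
  by case: s; rewrite /jet_pair /jet_q /jet_p0 /=; split; ring.
- rewrite !to_jetM !to_jetV !jetM_q !jetM_p0 !jetV_q !jetV_p0.
  rewrite -/(free2_gen s) !to_jet_gen h1 h2 h3 h4.
  by case: s; rewrite /jet_pair /jet_q /jet_p0 /=; split; ring.
Qed.

Lemma exp_lcs1 (x : free2) : lcs 1 x -> expa x = 0 /\ expb x = 0.
Proof. by move/(to_jet_lcs (jet_pair 1 0) (jet_pair 0 1))/jet_lcs1. Qed.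

Lemma area_lcs1 : additive_on (lcs 1) area.
Proof. by move=> x y /exp_lcs1[ax _] _; rewrite areaM ax mul0r addr0. Qed.

Lemma areaR x y : area [~ x, y]%g = expa x * expb y - expa y * expb x.
Proof. by rewrite /area /th1 to_jetR jetR_p1. Qed.

Let to_jet_additive X Y k (f : jet -> int) : (1 <= k)%N ->
  additive_on (lcs 1) f -> additive_on (lcs k) (fun x => f (to_jet X Y x)).
Proof.
move=> k1 fD x y kx ky; rewrite to_jetM fD //.
  exact/to_jet_lcs/(lcs_le k1 kx).
exact/to_jet_lcs/(lcs_le k1 ky).
Qed.

Let p1D : additive_on (lcs 1) jet_p1. Proof. by case: jet_additive. Qed.
Let p2D : additive_on (lcs 1) jet_p2. Proof. by case: jet_additive. Qed.
Let p3D : additive_on (lcs 1) jet_p3. Proof. by case: jet_additive. Qed.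

(** The changes of exponents behind [th2] and [th3] have determinant one, so they preserve the area
    form. *)
Let p1_eq (x : free2) : lcs 1 x -> jet_p1 (th2 x) = area x /\ jet_p1 (th3 x) = area x.
Proof.
move=> kx; split; move: x kx; apply: lcs_additive_eq => [||x y _].
- exact: to_jet_additive.
- exact: area_lcs1.
- rewrite areaR /th2 to_jetR jetR_p1 -/(th2 x) -/(th2 y).
  by have [-> -> _ _] := exponents x; have [-> -> _ _] := exponents y; ring.
- exact: to_jet_additive.
- exact: area_lcs1.
- rewrite areaR /th3 to_jetR jetR_p1 -/(th3 x) -/(th3 y).
  by have [_ _ -> ->] := exponents x; have [_ _ -> ->] := exponents y; ring.
Qed.

Lemma moment_lcs1 : additive_on (lcs 1) momenta /\ additive_on (lcs 1) momentb.
Proof. by split; apply: to_jet_additive. Qed.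

Let th_lcs1 X Y (x : free2) : lcs 1 x ->
  jet_q (to_jet X Y x) = 0 /\ jet_p0 (to_jet X Y x) = 0.
Proof. by move/(to_jet_lcs X Y)/jet_lcs1. Qed.

Lemma momentR (x y : free2) : lcs 1 x ->
  momenta [~ x, y]%g = - 2 * expa y * area x /\
  momentb [~ x, y]%g = - 2 * expb y * area x.
Proof.
move=> kx; rewrite /momenta /momentb /th1 /th2 !to_jetR.
have [q1 r1] := th_lcs1 (jet_pair 1 0) (jet_pair 0 1) kx.
have [q2 r2] := th_lcs1 (jet_pair 0 (-1)) (jet_pair 1 0) kx.
rewrite !jetR_p2 // -/(th2 y) -/(th2 x) (p1_eq kx).1.
by have [-> _ _ _] := exponents y.
Qed.

Let moment3 (x : free2) : lcs 2 x -> jet_p2 (th3 x) = momenta x + momentb x.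
Proof.
move: x; apply: lcs_additive_eq => [||x y kx].
- exact: to_jet_additive.
- have [aD bD] := moment_lcs1.
  by move=> x y /lcsS kx /lcsS ky; rewrite aD // bD // addrACA.
- have [-> ->] := momentR y kx.
  have [q3 r3] := th_lcs1 (jet_pair 1 0) (jet_pair 1 1) kx.
  rewrite /th3 to_jetR jetR_p2 // -/(th3 y) -/(th3 x) (p1_eq kx).2.
  by have [_ _ -> _] := exponents y; ring.
Qed.

Lemma quadratic_lcs1 l0 l1 l2 : additive_on (lcs 1) (quadratic l0 l1 l2).
Proof.
move=> x y kx ky; have thD X Y : jet_p3 (to_jet X Y (x * y)%g) =
    jet_p3 (to_jet X Y x) + jet_p3 (to_jet X Y y).
  exact: (@to_jet_additive X Y 1 _ isT p3D).
by rewrite /quadratic /th1 /th2 /th3 !thD; ring.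
Qed.

Lemma quadratic_lcs4 l0 l1 l2 (x : free2) : lcs 4 x -> quadratic l0 l1 l2 x = 0.
Proof.
by move=> kx; rewrite /quadratic !jet_lcs4 ?mulr0 ?addr0 //; apply: to_jet_lcs.
Qed.

Lemma quadraticR l0 l1 l2 (x y : free2) : lcs 2 x ->
  quadratic l0 l1 l2 [~ x, y]%g =
  - 3 * (l0 * expa y * momenta x + l1 * (expa y * momentb x + expb y * momenta x)
         + l2 * expb y * momentb x).
Proof.
move=> kx; rewrite /quadratic /th1 /th2 /th3.
have p3R X Y : jet_p3 (to_jet X Y [~ x, y]%g) =
    - 3 * jet_q (to_jet X Y y) * jet_p2 (to_jet X Y x).
  have [q0 r0] := th_lcs1 X Y (lcsS kx).
  by rewrite to_jetR jetR_p3 //; apply/jet_lcs2/to_jet_lcs.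
rewrite !p3R -/(th1 x) -/(th1 y) -/(th2 x) -/(th2 y) -/(th3 x) -/(th3 y).
rewrite (moment3 kx) -/(momenta x) -/(momentb x) -/(expa y).
by have [-> _ -> _] := exponents y; ring.
Qed.

End FreeGroup.

(** * Generators of the pure braid group by Schreier rewriting *)

Section BraidGenerators.
Variable n : nat.
Local Notation B := (braid n).

(* Out of range, [sg i] is 1. *)
Definition sg (i : nat) : B :=
  if insub i is Some j then @sigma n j else 1.

Lemma sgE (i : 'I_n.-1) : sg i = sigma i.
Proof. by rewrite /sg valK. Qed.

Lemma braid_class (u v : word 'I_n.-1) :
  braid_rel u v -> pres_class (@braid_rel n) u = pres_class (@braid_rel n) v.
Proof. by move=> uv; apply/pres_classP/word_cong_rel. Qed.

Lemma sg_comm i j : i.+2 <= j -> sg i * sg j = sg j * sg i.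
Proof.
move=> ij; rewrite /sg; case: insubP => [i' _ ii'|_]; last by rewrite mulg1 mul1g.
case: insubP => [j' _ jj'|_]; last by rewrite mulg1 mul1g.
have := @braid_class (word_gen i' ++ word_gen j') (word_gen j' ++ word_gen i').
rewrite !pres_classM_group; apply; apply: braid_rel_comm.
by rewrite /= in ii' jj'; rewrite ii' jj' ij.
Qed.

Lemma sg_braid i : i.+1 < n.-1 ->
  sg i.+1 * sg i * sg i.+1 = sg i * sg i.+1 * sg i.
Proof.
move=> i1n; have in_ := ltnW i1n.
rewrite /sg (insubT (fun i => i < n.-1) i1n) (insubT (fun i => i < n.-1) in_) /=.
have := @braid_class _ _ (@braid_rel_braid n (Ordinal in_) (Ordinal i1n) erefl).
by rewrite !pres_classM_group !mulgA.
Qed.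

Lemma braid_permM (x y : B) : braid_perm (x * y) = (braid_perm x * braid_perm y).
Proof. exact: gmulfM. Qed.

Lemma braid_perm1 : braid_perm (1 : B) = 1.
Proof. exact: gmulf1. Qed.

Lemma braid_permV (x : B) : braid_perm x^-1 = (braid_perm x)^-1.
Proof. exact: gmulfV. Qed.

Lemma braid_perm_sg i (k : 'I_n) : i < n.-1 ->
  braid_perm (sg i) k =
    (if k == i :> nat then i.+1 else if k == i.+1 :> nat then i else k) :> nat.
Proof.
by move=> lt_i; rewrite (sgE (Ordinal lt_i)) braid_perm_sigma adjacent_tpermE.
Qed.

Lemma pure_valM : {morph @pure_val n : p q / p * q}.
Proof. exact: (@gmulfM (pure_braid n) B val). Qed.

Lemma pure_valV : {morph @pure_val n : p / p^-1}.
Proof. exact: (@gmulfV (pure_braid n) B val). Qed.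

Lemma pure_sg2 (x : B) i : pure (x * sg i ^+ 2 * x^-1).
Proof.
apply/eqP; rewrite !braid_permM braid_permV.
suff -> : braid_perm (sg i) * braid_perm (sg i) = 1 by rewrite mulg1 mulgV.
rewrite /sg; case: insubP => [j _ _|_]; last by rewrite braid_perm1 mulg1.
by rewrite braid_perm_sigma tperm2.
Qed.

Definition pconj (x : B) (i : nat) : pure_braid n := PureBraid (pure_sg2 x i).

(* For k <= m this is the product of sigma_(m - 1), ..., sigma_k. *)
Fixpoint descent (m k : nat) : B :=
  if m is m'.+1 then (if k <= m' then sg m' * descent m' k else 1) else 1.

Lemma descent_ge m k : m <= k -> descent m k = 1.
Proof. by case: m => //= m; rewrite ltnNge => /negPf ->. Qed.

Lemma descent_commL m k i : i.+2 <= k -> descent m k * sg i = sg i * descent m k.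
Proof.
move=> ik; elim: m => [|m IHm] /=; first by rewrite mulg1 mul1g.
case: ifP => km; last by rewrite mulg1 mul1g.
by rewrite -mulgA IHm !mulgA (sg_comm (leq_trans ik km)).
Qed.

Lemma descent_commR m k i : m < i -> descent m k * sg i = sg i * descent m k.
Proof.
elim: m => [|m IHm] /= mi; first by rewrite mulg1 mul1g.
case: ifP => km; last by rewrite mulg1 mul1g.
by rewrite -mulgA IHm ?(ltnW mi) // !mulgA sg_comm.
Qed.

Lemma descentSr m i : i < m -> descent m i.+1 * sg i = descent m i.
Proof.
elim: m => // m IHm; rewrite ltnS => im /=; rewrite im.
move: im; rewrite leq_eqVlt => /predU1P[<-|im].
  by rewrite ltnn descent_ge // mulg1 mul1g.
by rewrite im -mulgA IHm.
Qed.

Lemma descent_braid m k j : m <= n.-1 -> k <= j -> j.+1 < m ->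
  descent m k * sg j.+1 = sg j * descent m k.
Proof.
elim: m => // m IHm mn kj; rewrite ltnS leq_eqVlt => /predU1P[eq_m|lt_jm].
  rewrite -eq_m /= (leqW kj) kj -!mulgA descent_commR //.
  by rewrite !mulgA sg_braid // eq_m.
have jm := ltnW lt_jm.
rewrite /= (leq_trans kj (ltnW jm)) -mulgA IHm //; last exact: ltnW.
by rewrite !mulgA (@sg_comm j m).
Qed.

(** Lifts of the permutations of positions 0, ..., m, built through the cosets of S_m in S_(m+1);
    [canon n.-1] is a transversal of the pure braid group. *)
Fixpoint canon (m : nat) : seq B :=
  if m is m'.+1
  then [seq t * descent m k | t <- canon m', k <- iota 0 m.+1]
  else [:: 1].

Lemma canonP m t : t \in canon m.+1 ->
  exists t0 k, [/\ t0 \in canon m, k <= m.+1 & t = t0 * descent m.+1 k].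
Proof.
case/allpairsP=> -[t0 k] [t0m km ->]; exists t0, k; split=> //.
by rewrite mem_iota in km.
Qed.

Lemma canonS m t : t \in canon m -> t \in canon m.+1.
Proof.
move=> tm; rewrite -[t]mulg1 -(descent_ge (leqnn m.+1)).
by apply: (allpairs_f (fun t k => t * descent m.+1 k)); rewrite // mem_iota /=.
Qed.

Lemma canon_le m m' t : m <= m' -> t \in canon m -> t \in canon m'.
Proof.
move/subnK <-; elim: (m' - m) => // d IHd /IHd; rewrite addSn; exact: canonS.
Qed.

(** Let the last factor of [t] be a descent to k. For i + 1 < k the generator commutes past it; for
    i + 1 = k it lengthens it; for i > k it passes through with index lowered by one, and the rest
    is induction. For i = k a square appears and leaves on the left as a conjugate. *)
Lemma canon_step m i t : m <= n.-1 -> i < m -> t \in canon m ->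
  exists2 t', t' \in canon m & exists r, t * sg i = r * t' /\
    (r = 1 \/ exists t0 j, [/\ t0 \in canon m, j < m & r = t0 * sg j ^+ 2 * t0^-1]).
Proof.
elim: m i t => // m IHm i t mn im /canonP[t0 [k [t0m km ->{t}]]]; set c := descent m.+1.
have canon_c t' k' : t' \in canon m -> k' <= m.+1 -> t' * c k' \in canon m.+1.
  move=> t'm k'm; apply: (allpairs_f (fun t k => t * descent m.+1 k)) => //.
  by rewrite mem_iota.
have lift j : j < m -> t0 * c k * sg i = t0 * sg j * c k ->
  exists2 t', t' \in canon m.+1 & exists r, t0 * c k * sg i = r * t' /\
    (r = 1 \/ exists t0 j, [/\ t0 \in canon m.+1, j < m.+1 & r = t0 * sg j ^+ 2 * t0^-1]).
  move=> jm ->; have [t' t'm [r [-> r_in]]] := IHm j t0 (ltnW mn) jm t0m.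
  exists (t' * c k); first exact: canon_c.
  exists r; rewrite mulgA; split=> //; case: r_in => [->|[t1 [l [t1m lm ->]]]]; first by left.
  by right; exists t1, l; split=> //; [apply: canonS | apply: ltnW].
case: (ltngtP i k) => [ik|ki|eq_ik].
- case: (ltngtP i.+1 k) => [i1k|/leq_trans/(_ ik)|eq_k]; last 2 first.
  + by rewrite ltnn.
  + exists (t0 * c i); first by apply: canon_c => //; apply: ltnW.
    exists 1; split; last by left.
    by rewrite mul1g -eq_k /c -mulgA descentSr.
  apply: (lift i); first by rewrite -ltnS; apply: leq_trans i1k km.
  by rewrite /c -!mulgA descent_commL.
- case: i im ki {lift}(lift i.-1) => // i im ki lift; apply: lift => //=.
  by rewrite /c -!mulgA descent_braid.
- have tc : t0 * c k.+1 \in canon m.+1 by apply: canon_c => //; rewrite -eq_ik.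
  exists (t0 * c k.+1) => //; exists (t0 * c k.+1 * sg k ^+ 2 * (t0 * c k.+1)^-1).
  split; last by right; exists (t0 * c k.+1), k; split=> //; rewrite -eq_ik.
  rewrite mulgVK eq_ik expgS expg1 !mulgA; congr (_ * _).
  by rewrite /c -!mulgA descentSr // -eq_ik.
Qed.

Lemma descent_perm m k (i : 'I_n) : m <= n.-1 -> k <= m ->
  (i == m :> nat -> braid_perm (descent m k) i = k :> nat) /\
  (m < i -> braid_perm (descent m k) i = i).
Proof.
move=> mn; elim: m mn i => [|m IHm] mn i km /=.
  by rewrite braid_perm1 !perm1; case: k km => // _; split=> [/eqP|].
case: ifP => [km'|/negbT]; last first.
  rewrite -ltnNge => mk; rewrite braid_perm1 perm1; split=> // /eqP ->.
  by apply/eqP; rewrite eqn_leq mk.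
rewrite braid_permM permM; have [h1 h2] := IHm (ltnW mn) (braid_perm (sg m) i) km'.
split=> [/eqP im|mi].
  by apply: h1; rewrite braid_perm_sg // im (gtn_eqF (ltnSn m)) eqxx.
have eq_i : braid_perm (sg m) i = i.
  apply: val_inj; rewrite /= braid_perm_sg //.
  by rewrite (gtn_eqF (ltnW mi)) (gtn_eqF mi).
by rewrite {h1}eq_i in h2 *; apply: h2; apply: ltnW.
Qed.

Lemma canon_perm_gt m t (i : 'I_n) : m <= n.-1 -> t \in canon m -> m < i ->
  braid_perm t i = i.
Proof.
elim: m t => [|m IHm] t mn.
  by rewrite inE => /eqP ->; rewrite braid_perm1 perm1.
case/canonP=> t0 [k [t0m km ->]] mi.
rewrite braid_permM permM (IHm t0) ?(ltnW mn) ?(ltnW mi) //.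
by have [_ ->] := descent_perm i mn km.
Qed.

Lemma canon_pure m t : m <= n.-1 -> t \in canon m -> pure t -> t = 1.
Proof.
elim: m t => [|m IHm] t mn; first by rewrite inE => /eqP.
case/canonP=> t0 [k [t0m km ->]].
move=> /eqP pt.
have m1n : m.+1 < n by rewrite -ltn_predRL.
have mk : k = m.+1.
  have := congr1 (fun s : 'S_n => s (Ordinal m1n) : nat) pt.
  rewrite perm1 braid_permM permM (canon_perm_gt (ltnW mn) t0m) //=.
  by have [-> //] := descent_perm (Ordinal m1n) mn km.
move: pt; rewrite mk descent_ge // mulg1 => pt.
by apply: IHm (ltnW mn) t0m _; apply/eqP.
Qed.

Lemma braid_canon (x : B) : exists t p, [/\ t \in canon n.-1, x = pure_val p * t &
  gspan (fun y => exists t i, [/\ t \in canon n.-1, i < n.-1 & y = pconj t i]) p].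
Proof.
set P := gspan _.
have step t i : t \in canon n.-1 -> i < n.-1 -> exists t' p,
    [/\ t' \in canon n.-1, t * sg i = pure_val p * t' & P p].
  move=> tc lt_i; have [t' t'c [r [-> r_in]]] := canon_step (leqnn _) lt_i tc.
  case: r_in => [->|[t1 [j [t1c jn ->]]]].
    by exists t', 1; split=> //; apply: gspan1.
  exists t', (pconj t1 j); split=> //.
  by apply: gspan_in; exists t1, j.
(* With s the generator, t s^-1 = (t s) s^-2: the representative of t s is reused, and s^-2 moves to
   its left as a conjugate. *)
have stepV t i : t \in canon n.-1 -> i < n.-1 -> exists t' p,
    [/\ t' \in canon n.-1, t * (sg i)^-1 = pure_val p * t' & P p].
  move=> tc lt_i; have [t' [p [t'c eq_t Pp]]] := step t i tc lt_i.
  exists t', (p * (pconj t' i)^-1); split=> //.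
    rewrite pure_valM pure_valV /= !invgM invgK !mulgA -eq_t.
    by rewrite mulgVK mulgK.
  apply: gspanM => //; apply: gspanV; apply: gspan_in.
  by exists t', i.
suff right_mul w : exists t p, [/\ t \in canon n.-1,
    pres_class (@braid_rel n) w = pure_val p * t & P p].
  by rewrite -[x]pres_classK; apply: right_mul.
elim/last_ind: w => [|w [i c] [t [p [tc eq_w Pp]]]].
  exists 1, 1; split; [|by rewrite mulg1|exact: gspan1].
  by apply: (@canon_le 0) => //; rewrite inE.
have [t' [q [t'c eq_t Pq]]] : exists t' q, [/\ t' \in canon n.-1,
    t * (if c then (sigma i)^-1 else sigma i) = pure_val q * t' & P q].
  rewrite -sgE; case: c; [exact: stepV | exact: step].
exists t', (p * q); split=> //; last exact: gspanM.
rewrite -cats1 pres_classM_group pres_class_letter -/(sigma i) eq_w.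
by rewrite pure_valM -!mulgA -eq_t.
Qed.

Lemma pure_braid_gen (p : pure_braid n) :
  gspan (fun y => exists t i, [/\ t \in canon n.-1, i < n.-1 & y = pconj t i]) p.
Proof.
have [t [q [tc eq_p Pq]]] := braid_canon (pure_val p).
suff -> : p = q by [].
apply: val_inj; rewrite /= eq_p (canon_pure (leqnn _) tc) ?mulg1 //.
have -> : t = (pure_val q)^-1 * pure_val p by rewrite eq_p mulKg.
by rewrite -pure_valV -pure_valM; apply: pure_valP.
Qed.

Lemma pure_braid_fin_gen : finitely_generated (pure_braid n).
Proof.
exists [seq pconj t i | t <- canon n.-1, i <- iota 0 n.-1] => p.
apply: gspan_sub (pure_braid_gen p) => _ [t [i [tc lt_i ->]]].
by apply: allpairs_f; rewrite // mem_iota.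
Qed.

End BraidGenerators.

(** * Additive functions on the pure braid group and full twists *)

Section PermutationGeneration.
Variable n : nat.
Local Notation B := (braid n).

(** Used with m = 0 for surjectivity onto the symmetric group, and with m = 2 for the stabilizer of
    the first two positions, whose generators lift to braids commuting with [sg n 0]. *)
Lemma adjacent_generation m (K : 'S_n -> Prop) :
    K 1 -> (forall s t, K s -> K t -> K (s * t)) ->
    (forall j, m <= j -> j < n.-1 -> K (braid_perm (@sg n j))) ->
  forall s : 'S_n, (forall i : 'I_n, i < m -> s i = i) -> K s.
Proof.
move=> K1 KM Kadj.
have Ktperm d (a b : 'I_n) : m <= a -> b = a + d.+1 :> nat -> K (tperm a b).
  elim: d a b => [|d IHd] a b ma eq_b; have bn := ltn_ord b.
    have an : a < n.-1 by lia.
    have := Kadj a ma an; rewrite (sgE (Ordinal an)) braid_perm_sigma.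
    rewrite /adjacent_tperm; congr (K (tperm _ _)); apply: val_inj => //=.
    by rewrite eq_b addn1.
  have cn : a + d.+1 < n by lia.
  pose c : 'I_n := Ordinal cn; have cn1 : c < n.-1 by rewrite /=; lia.
  have Kc : K (braid_perm (@sg n c)) by apply: Kadj => //=; lia.
  have adjE : braid_perm (@sg n c) = tperm c b.
    rewrite (sgE (Ordinal cn1)) braid_perm_sigma /adjacent_tperm.
    by congr (tperm _ _); apply: val_inj => //=; lia.
  have -> : tperm a b = tperm c b * tperm a c * tperm c b.
    have -> : tperm c b * tperm a c * tperm c b = (tperm a c) ^ (tperm c b).
      by rewrite /conjg tpermV mulgA.
    rewrite tpermJ tpermL tpermD //; apply/eqP => /(congr1 val) /=; lia.
  rewrite adjE in Kc; do 2![apply: (KM) => //]; exact: IHd.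
have {}Ktperm (a b : 'I_n) : m <= a -> m <= b -> K (tperm a b).
  move=> ma mb; case: (ltngtP a b) => [ab|ba|/val_inj ->].
  - by apply: (Ktperm (b - a).-1) => //; lia.
  - by rewrite tpermC; apply: (Ktperm (a - b).-1) => //; lia.
  - by rewrite tperm1.
move=> s; have [N] := ubnP #|[pred i | s i != i]|.
elim: N s => // N IHN s cardN fix_s.
case: (pickP [pred i | s i != i]) => [x /= sx|fixall]; last first.
  suff -> : s = 1 by [].
  by apply/permP => i; rewrite perm1; move/(_ i)/negbFE/eqP: fixall.
have mx : m <= x by rewrite leqNgt; apply: contra sx => /fix_s ->.
have msx : m <= s x.
  by rewrite leqNgt; apply: contra sx => /fix_s /perm_inj ->.
rewrite -[s](mulgK (tperm x (s x))) tpermV; apply: KM; last exact: Ktperm.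
have fix_st i : s i = i -> (s * tperm x (s x)) i = i.
  move=> si; rewrite permM si tpermD //; apply: contraNneq sx => eq_i.
    by rewrite eq_i si.
  by rewrite -eq_i in si; rewrite (perm_inj si).
apply: IHN => [|i im]; last by rewrite fix_st // fix_s.
rewrite -ltnS; apply: leq_trans cardN; rewrite ltnS; apply: proper_card.
apply/properP; split.
  by apply/fintype.subsetP => i; rewrite !inE; apply: contra => /eqP/fix_st ->.
by exists x; rewrite inE // permM tpermR eqxx.
Qed.

Lemma braid_perm_surj (s : 'S_n) : exists x : B, braid_perm x = s.
Proof.
apply: (@adjacent_generation 0 (fun s => exists x : B, braid_perm x = s)) =>
  // [|_ _ [x <-] [y <-]|j _ _].
- by exists 1; rewrite braid_perm1.
- by exists (x * y); rewrite braid_permM.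
- by exists (sg n j).
Qed.

Lemma perm_to_front (x0 : 'I_n) (l : seq 'I_n) : uniq l ->
  exists s : 'S_n, forall i, i < size l -> s (nth x0 l i) = i :> nat.
Proof.
elim/last_ind: l => [|l c IHl]; first by exists 1.
rewrite rcons_uniq => /andP[cl ul]; have [s sl] := IHl ul.
have ln : size l < n.
  have : uniq (rcons l c) by rewrite rcons_uniq cl.
  by move/card_uniqP; rewrite size_rcons => <-; rewrite -[leqRHS]card_ord max_card.
exists (s * tperm (s c) (Ordinal ln)) => i; rewrite size_rcons ltnS permM nth_rcons.
rewrite leq_eqVlt => /predU1P[->|il]; first by rewrite ltnn eqxx tpermL.
rewrite il tpermD ?sl //; apply/eqP.
  by move/perm_inj => eq_c; rewrite eq_c mem_nth in cl.
by move/(congr1 val); rewrite /= sl // => eq_i; rewrite -eq_i ltnn in il.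
Qed.

Lemma braid_to_front (x0 : 'I_n) (l : seq 'I_n) : uniq l ->
  exists x : B, forall i, i < size l -> braid_perm x (nth x0 l i) = i :> nat.
Proof.
move=> /(perm_to_front x0)[s sl]; have [x xs] := braid_perm_surj s.
by exists x; rewrite xs.
Qed.

(* Strands a and b are brought to positions 0 and 1; the value for a = b is
   irrelevant. *)
Definition front (a b : 'I_n) : B := xget 1 [set x : B |
  braid_perm x a = 0 :> nat /\ braid_perm x b = 1%N :> nat]%classic.

(** The full twist of two strands is natural only up to conjugacy in the pure braid group; the
    choice is harmless because only its values under additive functions matter. *)
Definition twist (a b : 'I_n) : pure_braid n := pconj (front a b) 0.

Lemma frontP (a b : 'I_n) : a != b ->
  braid_perm (front a b) a = 0 :> nat /\ braid_perm (front a b) b = 1%N :> nat.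
Proof.
move=> ab; rewrite /front; case: xgetP => [x _ //|none].
have [|x xl] := @braid_to_front a [:: a; b]; first by rewrite /= inE ab.
by case: (none x); split; [apply: (xl 0) | apply: (xl 1%N)].
Qed.

Lemma pure_val_inj : injective (@pure_val n).
Proof. exact: val_inj. Qed.

Lemma pure_conj (p : pure_braid n) (x : B) i :
  pconj (pure_val p * x) i = p * pconj x i * p^-1.
Proof.
by apply: pure_val_inj; rewrite 2!pure_valM pure_valV /= invgM !mulgA.
Qed.

Section Additive.
Variables (V : zmodType) (v : pure_braid n -> V).
Hypothesis vM : forall p q, v (p * q) = (v p + v q)%R.

Let v1 : v 1 = 0%R.
Proof. by apply: (addrI (v 1)); rewrite -vM mulg1 addr0. Qed.

Let vV p : v p^-1 = (- v p)%R.
Proof. by apply: (addrI (v p)); rewrite -vM mulgV v1 subrr. Qed.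

(** Two braids bringing a, b to positions 0, 1 differ by a pure braid on the left and, on the right,
    a braid [d] moving only the other positions. As [d] commutes with [sg n 0], the two twists are
    conjugate by a pure braid. *)
Lemma additive_front (x : B) (a b : 'I_n) :
  braid_perm x a = 0 :> nat -> braid_perm x b = 1%N :> nat ->
  v (pconj x 0) = v (twist a b).
Proof.
move=> xa xb; have ab : a != b by apply/eqP => ab; rewrite ab xb in xa.
have [fa fb] := frontP ab; set y := front a b in fa fb *.
have [d [perm_d comm_d]] : exists d : B,
    braid_perm d = (braid_perm y)^-1 * braid_perm x /\ d * sg n 0 = sg n 0 * d.
  move: (braid_perm x) xa xb => s sa sb.
  apply: (@adjacent_generation 2 (fun t => exists d : B,
    braid_perm d = t /\ d * sg n 0 = sg n 0 * d)) => [|_ _ [d [<- dC]] [e [<- eC]]|j j2 _|i].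
  - by exists 1; rewrite braid_perm1 mulg1 mul1g.
  - by exists (d * e); rewrite braid_permM -mulgA eC !mulgA dC.
  - by exists (sg n j); split=> //; rewrite -(@sg_comm n 0 j).
  - move=> i2; rewrite permM; apply: val_inj; rewrite /=.
    case: i i2 => [[|[|//]] lt_i] _ /=.
      suff -> : (braid_perm y)^-1 (Ordinal lt_i) = a by rewrite sa.
      by apply: (@perm_inj _ (braid_perm y)); rewrite permKV; apply: val_inj; rewrite /= fa.
    suff -> : (braid_perm y)^-1 (Ordinal lt_i) = b by rewrite sb.
    by apply: (@perm_inj _ (braid_perm y)); rewrite permKV; apply: val_inj; rewrite /= fb.
have pure_p : pure (x * d^-1 * y^-1).
  apply/eqP; rewrite !braid_permM !braid_permV perm_d invgM invgK !mulgA.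
  by rewrite mulgV mul1g mulgV.
pose p := PureBraid pure_p.
have -> : pconj x 0 = p * twist a b * p^-1.
  rewrite -pure_conj; apply: val_inj; rewrite /= -/y mulgVK.
  have -> : x * d^-1 * sg n 0 ^+ 2 * (x * d^-1)^-1 =
    x * (d^-1 * (sg n 0 ^+ 2 * d)) * x^-1 by rewrite invgM invgK !mulgA.
  have -> : sg n 0 ^+ 2 * d = d * sg n 0 ^+ 2.
    by rewrite expgS expg1 -mulgA -comm_d mulgA -comm_d mulgA.
  by rewrite mulKg.
by rewrite !vM vV addrC addKr.
Qed.

Lemma additive_twistC (a b : 'I_n) : a != b -> v (twist a b) = v (twist b a).
Proof.
move=> ab; have [fa fb] := frontP ab; set x := front a b in fa fb *.
have n1 : 0 < n.-1 by move: (ltn_ord (braid_perm x b)); rewrite fb; lia.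
rewrite -(@additive_front (x * sg n 0) b a).
- congr (v _); apply: val_inj; rewrite /= -/x invgM expgS expg1 !mulgA.
  by rewrite mulgK.
- by rewrite braid_permM permM braid_perm_sg // fb.
- by rewrite braid_permM permM braid_perm_sg // fa.
Qed.

(** sigma_i sigma_(i+1) conjugates sigma_i into sigma_(i+1), so the pair can be moved down one
    position without changing the pure braid. *)
Lemma additive_pconj (x : B) i (a b : 'I_n) : i < n.-1 ->
  braid_perm x a = i :> nat -> braid_perm x b = i.+1 :> nat ->
  v (pconj x i) = v (twist a b).
Proof.
elim: i x => [|i IHi] x; first by move=> _; apply: additive_front.
move=> lt_i xa xb; rewrite -(IHi (x * (sg n i * sg n i.+1))) ?(ltnW lt_i) //.
- congr (v _); apply: val_inj; rewrite /=; set h := sg n i * _.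
  have hC : h * sg n i = sg n i.+1 * h by rewrite /h mulgA sg_braid.
  move: h hC => h hC.
  have h2 : h * sg n i ^+ 2 = sg n i.+1 ^+ 2 * h.
    by rewrite !expgS !expg0 !mulg1 mulgA hC -mulgA hC mulgA.
  by rewrite -(mulgA x h) h2 invgM !mulgA mulgK.
- rewrite !braid_permM !permM braid_perm_sg // braid_perm_sg ?(ltnW lt_i) // xa.
  rewrite (gtn_eqF (ltnSn i)) eqxx /=; by do ?[case: eqP => ? /=]; lia.
- rewrite !braid_permM !permM braid_perm_sg // braid_perm_sg ?(ltnW lt_i) // xb.
  have [-> ->] : i.+2 == i = false /\ i.+2 == i.+1 = false by lia.
  by rewrite eqxx; case: eqP => //; lia.
Qed.

(** The twists generate the abelianization; identities between additive functions are checked on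
    them. *)
Lemma additive_eq0 : (forall a b : 'I_n, a != b -> v (twist a b) = 0%R) ->
  forall p, v p = 0%R.
Proof.
move=> v0 p; elim: {p}(pure_braid_gen p) => [_ [t [i [_ lt_i ->]]]||p q _ vp _ vq|p _ vp].
- have i1n : i.+1 < n by lia.
  pose s := (braid_perm t)^-1.
  rewrite (@additive_pconj t i (s (Ordinal (ltnW i1n))) (s (Ordinal i1n))) ?permKV //.
  apply: v0; apply/eqP => /perm_inj /(congr1 val) /=; lia.
- exact: v1.
- by rewrite vM vp vq addr0.
- by rewrite vV vp oppr0.
Qed.

End Additive.
End PermutationGeneration.

(** a^2 (b a^2 b^-1) b^2 = (a b)^3 is the full twist on three strands, central in the subgroup
    generated by [a] and [b]. *)
Lemma full_twist_comm (G : groupType) (a b : G) : b * a * b = a * b * a ->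
  a ^+ 2 * (a ^+ 2 * (a ^+ 2 ^ b^-1 * b ^+ 2)) =
  a ^+ 2 * (a ^+ 2 ^ b^-1 * b ^+ 2) * a ^+ 2.
Proof.
move=> ab; rewrite /conjg invgK !expgS expg0 !mulg1 -!mulgA !mulKg.
have comm : b * (a * (a * (b * a))) = a * (b * (a * (a * b))).
  have ab2 w : b * (a * (b * w)) = a * (b * (a * w)).
    by rewrite mulgA mulgA ab -!mulgA.
  by move: ab; rewrite -!mulgA => <-; apply: ab2.
have comm2 w : b * (a * (a * (b * (a * w)))) = a * (b * (a * (a * (b * w)))).
  by move: (congr1 (mulg^~ w) comm); rewrite /= -!mulgA.
by rewrite comm2 comm.
Qed.

(** * Relations imposed on exponent vectors by commuting twists *)

Section BraidRelations.
Variables (n : nat) (v u : pure_braid n -> int).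
Local Notation B := (braid n).
Hypotheses (vM : forall p q, v (p * q) = (v p + v q)%R)
  (uM : forall p q, u (p * q) = (u p + u q)%R).
Hypothesis vuC : forall p q, p * q = q * p -> (v p * u q = v q * u p)%R.

Lemma pconjE (x : B) i : pure_val (pconj x i) = (sg n i ^+ 2) ^ x^-1.
Proof. by rewrite /conjg invgK (mulgA x). Qed.

Lemma twist_disjoint (a b c d : 'I_n) : uniq [:: a; b; c; d] ->
  (v (twist a b) * u (twist c d))%R = (v (twist c d) * u (twist a b))%R.
Proof.
move=> abcd; have [x xl] := braid_to_front a abcd.
have xa := xl 0 isT; have xb := xl 1%N isT.
have xc := xl 2 isT; have xd := xl 3 isT; rewrite /= in xa xb xc xd.
have n2 : 2 < n.-1 by move: (ltn_ord (braid_perm x d)); rewrite xd; lia.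
rewrite -!(additive_pconj vM n2 xc xd) -!(additive_pconj uM n2 xc xd).
rewrite -!(additive_front vM xa xb) -!(additive_front uM xa xb).
apply: vuC; apply: pure_val_inj; rewrite !pure_valM !pconjE -!conjMg.
have sC : sg n 0 ^+ 2 * sg n 2 ^+ 2 = sg n 2 ^+ 2 * sg n 0 ^+ 2.
  by apply: commuteX2; apply: sg_comm.
by rewrite sC.
Qed.

(** The twist of a, b commutes with the full twist on a, b, c, a product of three pairwise twists;
    the term common to both sides cancels. *)
Lemma twist_triangle (a b c : 'I_n) : uniq [:: a; b; c] ->
  (v (twist a b) * (u (twist a c) + u (twist b c)) =
   (v (twist a c) + v (twist b c)) * u (twist a b))%R.
Proof.
move=> abc; have [x xl] := braid_to_front a abc.
have xa := xl 0 isT; have xb := xl 1%N isT.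
have xc := xl 2 isT; rewrite /= in xa xb xc.
have n1 : 1 < n.-1 by move: (ltn_ord (braid_perm x c)); rewrite xc; lia.
have ya : braid_perm (x * sg n 1) a = 0 :> nat.
  by rewrite braid_permM permM braid_perm_sg // xa.
have yc : braid_perm (x * sg n 1) c = 1%N :> nat.
  by rewrite braid_permM permM braid_perm_sg // xc.
rewrite -(additive_pconj vM n1 xb xc) -(additive_pconj uM n1 xb xc).
rewrite -!(additive_front vM xa xb) -!(additive_front uM xa xb).
rewrite -(additive_front vM ya yc) -(additive_front uM ya yc).
set p := pconj x 0; set q := pconj _ 0; set r := pconj x 1.
suff : (v p * u (p * (q * r))%g)%R = (v (p * (q * r))%g * u p)%R.
  by rewrite !vM !uM mulrDr [in RHS]mulrDl => /addrI.
apply: vuC; apply: pure_val_inj; rewrite !pure_valM !pconjE invgM conjgM -!conjMg; congr (_ ^ _).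
exact/full_twist_comm/sg_braid.
Qed.

End BraidRelations.

(** * Classification of isotropic planes *)

Section Classification.
Local Open Scope ring_scope.

(** p, q, r, s, t are the vectors (v, u) on ab, ac, ad, bd, cd, and bc is - (p + q). Disjoint pairs
    are parallel; the triangles abd and acd then make r, s, t the multiples of bc, ac, ab by one
    factor X / D. The other relation of abd reads X^2 = X D, so the factor is 0 or 1. *)
Lemma triangle_star (p1 p2 q1 q2 r1 r2 s1 s2 t1 t2 : int) :
    r1 * (p2 + q2) = (p1 + q1) * r2 -> s1 * q2 = q1 * s2 -> t1 * p2 = p1 * t2 ->
    p1 * (r2 + s2) = (r1 + s1) * p2 -> r1 * (p2 + s2) = (p1 + s1) * r2 ->
    q1 * (r2 + t2) = (r1 + t1) * q2 -> p1 * q2 - q1 * p2 != 0 ->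
  exists e : bool,
    [/\ (r1 = - (p1 + q1) *+ e), (r2 = - (p2 + q2) *+ e), s1 = q1 *+ e,
      s2 = q2 *+ e & t1 = p1 *+ e] /\ t2 = p2 *+ e.
Proof.
move=> H1 H2 H3 H4 H5 H6; set D := _ - _ => D0.
pose X := r1 * p2 - p1 * r2.
have zero (x y k : int) : x = y -> k * (x - y) = 0 by move=> ->; rewrite subrr mulr0.
have cancel (x y : int) : D * x = D * y -> x = y by apply: mulfI.
have Dr1 : D * r1 = - X * (p1 + q1).
  by apply/eqP; rewrite -subr_eq0 -(zero _ _ p1 H1) /D /X; apply/eqP; ring.
have Dr2 : D * r2 = - X * (p2 + q2).
  by apply/eqP; rewrite -subr_eq0 -(zero _ _ p2 H1) /D /X; apply/eqP; ring.
have Ds1 : D * s1 = X * q1.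
  apply/eqP; rewrite -subr_eq0 -(zero _ _ p1 H2) -[eqbRHS]addr0 -(zero _ _ q1 H4).
  by rewrite /D /X; apply/eqP; ring.
have Ds2 : D * s2 = X * q2.
  apply/eqP; rewrite -subr_eq0 -(zero _ _ p2 H2) -[eqbRHS]addr0 -(zero _ _ q2 H4).
  by rewrite /D /X; apply/eqP; ring.
have Dt1 : D * t1 = X * p1.
  apply/eqP; rewrite -subr_eq0 -(zero _ _ (- q1) H3).
  rewrite -[eqbRHS]addr0 -(zero _ _ (- p1) H6) -[eqbRHS]addr0 -(zero _ _ (- p1) H1).
  by rewrite /D /X; apply/eqP; ring.
have Dt2 : D * t2 = X * p2.
  apply/eqP; rewrite -subr_eq0 -(zero _ _ (- q2) H3).
  rewrite -[eqbRHS]addr0 -(zero _ _ (- p2) H6) -[eqbRHS]addr0 -(zero _ _ (- p2) H1).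
  by rewrite /D /X; apply/eqP; ring.
have XX : X * X = X * D.
  apply: cancel.
  have -> : D * (X * X) = (D * s1) * (D * r2) - (D * r1) * (D * s2).
    by rewrite Dr1 Dr2 Ds1 Ds2 /D; ring.
  apply/eqP; rewrite -subr_eq0 -(zero _ _ (- D * D) H5) /X; apply/eqP; ring.
have [X0|X0] := eqVneq X 0.
  exists false; rewrite !mulr0n.
  by split; [split|]; apply: cancel; rewrite mulr0 ?Dr1 ?Dr2 ?Ds1 ?Ds2 ?Dt1 ?Dt2 X0 ?oppr0 mul0r.
have XD : X = D by apply: (mulfI X0).
exists true; rewrite !mulr1n.
by split; [split|]; apply: cancel; rewrite ?Dr1 ?Dr2 ?Ds1 ?Ds2 ?Dt1 ?Dt2 XD // mulNr mulrN.
Qed.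

Local Ltac distinct :=
  rewrite /= ?inE ?negb_or; repeat (apply/andP; split);
  first [done | by rewrite eq_sym].

Section IsotropicSystem.
Variable T : eqType.

Record isotropic_system (v u : T -> T -> int) : Prop := IsotropicSystem {
  iso_symv : forall a b, a != b -> v a b = v b a;
  iso_symu : forall a b, a != b -> u a b = u b a;
  iso_disjoint : forall a b c d, uniq [:: a; b; c; d] -> v a b * u c d = v c d * u a b;
  iso_triangle : forall a b c, uniq [:: a; b; c] ->
    v a b * (u a c + u b c) = (v a c + v b c) * u a b }.

Definition triangle_det (v u : T -> T -> int) a b c := v a b * u a c - v a c * u a b.
(** Relative to a nondegenerate triangle abc, tells whether [d] is a fourth strand of the plane; by
    [iso_star], testing at [a] is enough. *)
Definition star_bit (v u : T -> T -> int) a d := (v a d != 0) || (u a d != 0).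

Section OneSystem.
Variables (v u : T -> T -> int) (a b c : T).
Hypotheses (vuA : isotropic_system v u) (abc : uniq [:: a; b; c]).
Hypothesis D0 : triangle_det v u a b c != 0.

Let ab : a != b. Proof. by move: abc; rewrite /= !inE !negb_or => /andP[/andP[]]. Qed.
Let ac : a != c. Proof. by move: abc; rewrite /= !inE !negb_or => /andP[/andP[]]. Qed.
Let bc : b != c. Proof. by move: abc; rewrite /= !inE !negb_or => /and3P[]. Qed.

(** The vectors of ab and ac are each parallel to the sum over the triangle; being independent, they
    force that sum to vanish. *)
Lemma iso_triangle_sum : v b c = - (v a b + v a c) /\ u b c = - (u a b + u a c).
Proof.
have H1 := iso_triangle vuA abc.
have acb : uniq [:: a; c; b].
  by rewrite /= !inE !negb_or ab ac eq_sym bc.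
have H2 := iso_triangle vuA acb; rewrite -(iso_symv vuA bc) -(iso_symu vuA bc) in H2.
move: D0; rewrite /triangle_det => D1.
have cancel x : (v a b * u a c - v a c * u a b) * x = 0 -> x = 0.
  by move/eqP; rewrite mulf_eq0 (negPf D1) => /eqP.
have zero (x y k : int) : x = y -> k * (x - y) = 0 by move=> ->; rewrite subrr mulr0.
split; apply/eqP; rewrite -subr_eq0; apply/eqP; apply: cancel.
  transitivity (v a c * (v a b * (u a c + u b c) - (v a c + v b c) * u a b)
    - v a b * (v a c * (u a b + u b c) - (v a b + v b c) * u a c)); first by ring.
  by rewrite !zero // subrr.
transitivity (u a c * (v a b * (u a c + u b c) - (v a c + v b c) * u a b)
  - u a b * (v a c * (u a b + u b c) - (v a b + v b c) * u a c)); first by ring.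
by rewrite !zero // subrr.
Qed.

(** Either the edges at [d] vanish, or opposite edges of the tetrahedron abcd carry equal vectors:
    the pattern of the map P_4 -> P_3 given by the resolvent cubic. *)
Lemma iso_star d : d \notin [:: a; b; c] ->
  let e := star_bit v u a d in
  [/\ v a d = v b c *+ e, u a d = u b c *+ e, v b d = v a c *+ e & u b d = u a c *+ e]
  /\ (v c d = v a b *+ e /\ u c d = u a b *+ e).
Proof.
rewrite !inE !negb_or => /and3P[da db dc] e.
have [vbc ubc] := iso_triangle_sum.
have H1 : v a d * u b c = v b c * u a d by apply: (iso_disjoint vuA); distinct.
have H2 : v b d * u a c = v a c * u b d by apply: (iso_disjoint vuA); distinct.
have H3 : v c d * u a b = v a b * u c d by apply: (iso_disjoint vuA); distinct.
have H4 : v a b * (u a d + u b d) = (v a d + v b d) * u a b.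
  by apply: (iso_triangle vuA); distinct.
have H5 : v a d * (u a b + u b d) = (v a b + v b d) * u a d.
  rewrite (iso_symv vuA (a := b) (b := d)) 1?eq_sym //.
  rewrite (iso_symu vuA (a := b) (b := d)) 1?eq_sym //.
  by apply: (iso_triangle vuA); distinct.
have H6 : v a c * (u a d + u c d) = (v a d + v c d) * u a c.
  by apply: (iso_triangle vuA); distinct.
have {}H1 : v a d * (u a b + u a c) = (v a b + v a c) * u a d.
  by move: H1; rewrite vbc ubc mulrN mulNr => /oppr_inj.
have [e' [[rv ru sv su tv] tu]] := triangle_star H1 H2 H3 H4 H5 H6 D0.
suff ee' : e = e' by rewrite ee' vbc ubc.
rewrite /e /star_bit rv ru; case: e' {rv ru sv su tv tu} => /=; last first.
  by [].
apply: contraNT D0; rewrite negb_or !negbK !oppr_eq0.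
rewrite !addr_eq0 => /andP[/eqP vab /eqP uab].
by rewrite /triangle_det vab uab mulrN mulNr; apply/eqP; ring.
Qed.

(** The pairs ad and bd' would be disjoint, hence parallel, while carrying the independent vectors
    of bc and ac. *)
Lemma star_bit_unique d d' : d \notin [:: a; b; c] -> d' \notin [:: a; b; c] ->
  star_bit v u a d -> star_bit v u a d' -> d = d'.
Proof.
move=> dabc d'abc ed ed'; apply/eqP/negPn/negP => dd'.
have [[vad uad _ _] _] := iso_star dabc; have [[_ _ vbd' ubd'] _] := iso_star d'abc.
rewrite ed ed' !mulr1n in vad uad vbd' ubd'.
move: dabc d'abc; rewrite !inE !negb_or => /and3P[da db dc] /and3P[d'a d'b d'c].
have : v a d * u b d' = v b d' * u a d by apply: (iso_disjoint vuA); distinct.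
have [vbc ubc] := iso_triangle_sum.
rewrite vad uad vbd' ubd' vbc ubc => eq; move: D0; rewrite /triangle_det => /negP[].
rewrite -(oppr_eq0 (_ - _)); apply/eqP.
transitivity (- (v a b + v a c) * u a c - v a c * - (u a b + u a c)); first by ring.
by rewrite eq subrr.
Qed.

(** The pair dd' is disjoint from ab and from ac, hence parallel to two independent vectors. *)
Lemma iso_outside d d' : d \notin [:: a; b; c] -> d' \notin [:: a; b; c] ->
  d != d' -> v d d' = 0 /\ u d d' = 0.
Proof.
rewrite !inE !negb_or => /and3P[da db dc] /and3P[d'a d'b d'c] dd'.
have H1 : v d d' * u a b = v a b * u d d' by apply: (iso_disjoint vuA); distinct.
have H2 : v d d' * u a c = v a c * u d d' by apply: (iso_disjoint vuA); distinct.
have zero (x y k : int) : x = y -> k * (x - y) = 0 by move=> ->; rewrite subrr mulr0.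
split; apply: (mulfI D0); rewrite mulr0 /triangle_det.
  transitivity (v a b * (v d d' * u a c - v a c * u d d')
    - v a c * (v d d' * u a b - v a b * u d d')); first by ring.
  by rewrite !zero // subrr.
transitivity (u a b * (v d d' * u a c - v a c * u d d')
  - u a c * (v d d' * u a b - v a b * u d d')); first by ring.
by rewrite !zero // subrr.
Qed.

End OneSystem.

(** Two pairs share a strand, where a degenerate triangle applies, or are disjoint, where isotropy
    does. Parallelism is not transitive at zero vectors, so each case is treated directly. *)
Lemma iso_degenerate v u : isotropic_system v u ->
    (forall a b c, uniq [:: a; b; c] -> triangle_det v u a b c = 0) ->
  forall a b c d, a != b -> c != d -> v a b * u c d = v c d * u a b.
Proof.
move=> vuA det0 a b c d ab cd.
have share x y z : x != y -> x != z -> v x y * u x z = v x z * u x y.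
  move=> xy xz; case: (eqVneq y z) => [->//|yz].
  by apply/eqP; rewrite -subr_eq0; apply/eqP/det0; distinct.
case: (eqVneq a c) cd => [<-|ac] cd; first exact: share.
case: (eqVneq a d) cd => [<-|ad] cd.
  rewrite (iso_symv vuA (a := c)) // (iso_symu vuA (a := c)) //.
  by apply: share => //; rewrite eq_sym.
case: (eqVneq b c) cd => [<-|bc] cd.
  rewrite (iso_symv vuA (a := a)) // (iso_symu vuA (a := a)) //.
  by apply: share => //; rewrite eq_sym.
case: (eqVneq b d) cd => [<-|bd] cd.
  rewrite (iso_symv vuA (a := c)) // (iso_symu vuA (a := c)) //.
  rewrite (iso_symv vuA (a := a)) // (iso_symu vuA (a := a)) //.
  by apply: share => //; rewrite eq_sym.
by apply: (iso_disjoint vuA); distinct.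
Qed.

(* Two systems of the same combinatorial type differ by a linear map of the
   plane, given here by Cramer's rule. *)
Lemma iso_same_type v u v' u' a b c :
    isotropic_system v u -> isotropic_system v' u' -> uniq [:: a; b; c] ->
    triangle_det v u a b c != 0 -> triangle_det v' u' a b c != 0 ->
    (forall d, d \notin [:: a; b; c] -> star_bit v u a d = star_bit v' u' a d) ->
  forall x y, x != y -> triangle_det v u a b c * v' x y =
    (v x y * u a c - v a c * u x y) * v' a b +
    (v a b * u x y - v x y * u a b) * v' a c.
Proof.
move=> vuA vuA' abc D0 D0' eps; set L := triangle_det v u a b c.
pose R x y := L * v' x y = (v x y * u a c - v a c * u x y) * v' a b +
    (v a b * u x y - v x y * u a b) * v' a c.
have Rsym x y : x != y -> R x y -> R y x.
  move=> xy; rewrite /R (iso_symv vuA xy) (iso_symu vuA xy).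
  by rewrite (iso_symv vuA' xy).
have Rab : R a b by rewrite /R /L /triangle_det; ring.
have Rac : R a c by rewrite /R /L /triangle_det; ring.
have Rbc : R b c.
  have [vbc ubc] := iso_triangle_sum vuA abc D0.
  have [vbc' _] := iso_triangle_sum vuA' abc D0'.
  by rewrite /R vbc ubc vbc' /L /triangle_det; ring.
have Rmul x y z t (e : bool) : R z t -> v x y = v z t *+ e -> u x y = u z t *+ e ->
    v' x y = v' z t *+ e -> R x y.
  rewrite /R => Rzt -> -> ->; case: e; rewrite ?mulr1n // !mulr0n; ring.
have Rstar d : d \notin [:: a; b; c] -> [/\ R a d, R b d & R c d].
  move=> dabc; have [[v1 u1 v2 u2] [v3 u3]] := iso_star vuA abc D0 dabc.
  have [[v1' _ v2' _] [v3' _]] := iso_star vuA' abc D0' dabc.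
  rewrite -(eps d dabc) in v1' v2' v3'.
  by split; [apply: Rmul Rbc v1 u1 v1' | apply: Rmul Rac v2 u2 v2' | apply: Rmul Rab v3 u3 v3'].
have Rout d d' : d \notin [:: a; b; c] -> d' \notin [:: a; b; c] -> d != d' -> R d d'.
  move=> dabc d'abc dd'; have [v0 u0] := iso_outside vuA abc D0 dabc d'abc dd'.
  have [v0' _] := iso_outside vuA' abc D0' dabc d'abc dd'.
  by rewrite /R v0 u0 v0'; ring.
have distinct_abc : [/\ a != b, a != c & b != c].
  by move: abc; rewrite /= !inE negb_or andbT => /andP[/andP[-> ->] ->].
have [ab ac bc] := distinct_abc.
have Rin x y : x \in [:: a; b; c] -> y \in [:: a; b; c] -> x != y -> R x y.
  rewrite !inE => /or3P[]/eqP-> /or3P[]/eqP->; rewrite ?eqxx // => _ //; exact: Rsym.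
have Rio x y : x \in [:: a; b; c] -> y \notin [:: a; b; c] -> R x y.
  by move=> + /Rstar[Ra Rb Rc]; rewrite !inE => /or3P[]/eqP->.
move=> x y xy; rewrite -/(R x y).
have [xi|xo] := boolP (x \in [:: a; b; c]); have [yi|yo] := boolP (y \in [:: a; b; c]).
- exact: Rin.
- exact: Rio.
- by apply: Rsym; [rewrite eq_sym | apply: Rio].
- exact: Rout.
Qed.

End IsotropicSystem.
End Classification.

(* The pure braid group on strands 0, 1, 2 modulo its centre is the
   fundamental group of the thrice punctured sphere.  Its three real intervals
   are indexed by the middle strand; an exchange of two of the strands moves
   from one interval to another through the upper or the lower half-plane.
   Paths through the upper half-plane are sent to 1, and a lower path from the
   interval m to the interval m' is sent to u m * (u m')^-1. *)
Section ThreeStrandCocycle.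

Definition swp (i x : nat) : nat :=
  if x == i then i.+1 else if x == i.+1 then i else x.

Lemma swpl i : swp i i = i.+1. Proof. by rewrite /swp eqxx. Qed.

Lemma swpr i : swp i i.+1 = i.
Proof. by rewrite /swp eqxx (gtn_eqF (ltnSn i)). Qed.

Lemma swp_id i x : x != i -> x != i.+1 -> swp i x = x.
Proof. by rewrite /swp => /negPf -> /negPf ->. Qed.

Definition middle (x0 x1 x2 : nat) : nat :=
  if (x0 < x1) (+) (x0 < x2) then 0 else if (x0 < x1) (+) (x1 < x2) then 2 else 1%N.

(** The sign of the order of the three strands, times the parity of how many sit at positions <= i;
    the parity tells whether the left two or the right two are exchanged. If no two of the three are
    exchanged the bit is immaterial: [middle] is unchanged and [cross] is 1. *)
Definition lower_half (i x0 x1 x2 : nat) : bool :=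
  (x0 < x1) (+) (x0 < x2) (+) (x1 < x2) (+) (x0 <= i) (+) (x1 <= i) (+) (x2 <= i).

Variables (H : groupType) (u : nat -> H).

Definition cross (i x0 x1 x2 : nat) : H :=
  if lower_half i x0 x1 x2
  then u (middle x0 x1 x2) * (u (middle (swp i x0) (swp i x1) (swp i x2)))^-1
  else 1.

Inductive window (i x : nat) : Prop :=
| WindowL of x = i | WindowM of x = i.+1 | WindowR of x = i.+2
| WindowLow of x < i | WindowHigh of i.+2 < x.

Lemma windowP i x : window i x.
Proof.
have [e|[e|[e|[e|e]]]] : x = i \/ x = i.+1 \/ x = i.+2 \/ x < i \/ i.+2 < x by lia.
all: by constructor.
Qed.

Lemma window_base i :
  (((i < i) = false) * ((i < i.+1) = true) * ((i < i.+2) = true)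
  * ((i.+1 < i) = false) * ((i.+1 < i.+1) = false) * ((i.+1 < i.+2) = true)
  * ((i.+2 < i) = false) * ((i.+2 < i.+1) = false) * ((i.+2 < i.+2) = false)
  * ((i <= i) = true) * ((i <= i.+1) = true))
  * ((swp i i = i.+1) * (swp i i.+1 = i) * (swp i i.+2 = i.+2)
  * (swp i.+1 i = i) * (swp i.+1 i.+1 = i.+2) * (swp i.+1 i.+2 = i.+1))%type.
Proof.
rewrite !swpl !swpr !swp_id; try lia.
by do !split; lia.
Qed.

Lemma window_low i x : x < i ->
  (((x < i) = true) * ((x < i.+1) = true) * ((x < i.+2) = true)
  * ((i < x) = false) * ((i.+1 < x) = false) * ((i.+2 < x) = false)
  * ((x <= i) = true) * ((x <= i.+1) = true))
  * ((swp i x = x) * (swp i.+1 x = x))%type.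
Proof. by move=> xi; rewrite !swp_id; try lia; do !split; lia. Qed.

Lemma window_high i x : i.+2 < x ->
  (((x < i) = false) * ((x < i.+1) = false) * ((x < i.+2) = false)
  * ((i < x) = true) * ((i.+1 < x) = true) * ((i.+2 < x) = true)
  * ((x <= i) = false) * ((x <= i.+1) = false))
  * ((swp i x = x) * (swp i.+1 x = x))%type.
Proof. by move=> xi; rewrite !swp_id; try lia; do !split; lia. Qed.

(** Positions matter only relative to i, i + 1, i + 2, five cases per strand; the comparisons left
    between strands outside this window are settled by trying both values. *)
Lemma cross_braid i x0 x1 x2 : x0 != x1 -> x0 != x2 -> x1 != x2 ->
  let s := swp i in let t := swp i.+1 in
  cross i.+1 x0 x1 x2 * cross i (t x0) (t x1) (t x2) *
    cross i.+1 (s (t x0)) (s (t x1)) (s (t x2)) =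
  cross i x0 x1 x2 * cross i.+1 (s x0) (s x1) (s x2) *
    cross i (t (s x0)) (t (s x1)) (t (s x2)).
Proof.
move=> h01 h02 h12 /=; have base := window_base i.
have [e0|e0|e0|/window_low e0|/window_high e0] := windowP i x0;
have [e1|e1|e1|/window_low e1|/window_high e1] := windowP i x1;
try (by rewrite e0 e1 eqxx in h01);
have [e2|e2|e2|/window_low e2|/window_high e2] := windowP i x2;
try (by rewrite e0 e2 eqxx in h02); try (by rewrite e1 e2 eqxx in h12).
all: rewrite /cross ?(e0, e1, e2, base) /lower_half /middle ?(e0, e1, e2, base) /=.
all: repeat match goal with |- context [leq ?a ?b] => case: (leq a b) end.
all: by rewrite /= !gnorm.
Qed.

End ThreeStrandCocycle.

Section CrossComm.
Variables (H : groupType) (u : nat -> H).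
Local Notation cross := (cross u).

Lemma swp_comm i j x : i.+2 <= j -> swp i (swp j x) = swp j (swp i x).
Proof.
move=> ij; have [->|[->|[->|[->|e]]]] : x = i \/ x = i.+1 \/ x = j \/ x = j.+1 \/
  (x != i /\ x != i.+1 /\ x != j /\ x != j.+1) by lia.
- by rewrite swpl !(@swp_id j) ?swpl //; lia.
- by rewrite swpr !(@swp_id j) ?swpr //; lia.
- by rewrite swpl !(@swp_id i) ?swpl //; lia.
- by rewrite swpr !(@swp_id i) ?swpr //; lia.
- by case: e => [? [? [? ?]]]; rewrite !swp_id.
Qed.

Lemma swp_lt i x y : x != y -> ~~ ((x == i) && (y == i.+1)) ->
  ~~ ((y == i) && (x == i.+1)) -> (swp i x < swp i y) = (x < y).
Proof. by move=> *; rewrite /swp; do ?[case: eqP => ? /=]; lia. Qed.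

Lemma swp_le i j x : i != j -> (swp i x <= j) = (x <= j).
Proof. by move=> *; rewrite /swp; do ?[case: eqP => ? /=]; lia. Qed.

Lemma swp_eq j k x : k != j -> k != j.+1 -> (swp j x == k) = (x == k).
Proof. by move=> *; rewrite /swp; do ?[case: (x =P _) => ? /=]; lia. Qed.

Lemma swp_inj i : injective (swp i).
Proof. by move=> x y; rewrite /swp; do ?[case: eqP => ? /=]; lia. Qed.

Definition touches (i x0 x1 x2 : nat) : bool :=
  ((x0 == i) || (x1 == i) || (x2 == i)) &&
  ((x0 == i.+1) || (x1 == i.+1) || (x2 == i.+1)).

Lemma untouched_middle i x0 x1 x2 : x0 != x1 -> x0 != x2 -> x1 != x2 ->
  ~~ touches i x0 x1 x2 ->
  [/\ (swp i x0 < swp i x1) = (x0 < x1), (swp i x0 < swp i x2) = (x0 < x2) &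
      (swp i x1 < swp i x2) = (x1 < x2)].
Proof.
move=> h01 h02 h12; rewrite /touches => no.
by split; apply: swp_lt => //; apply: contra no => /andP[-> ->]; rewrite ?orbT.
Qed.

Lemma cross_untouched i j x0 x1 x2 : x0 != x1 -> x0 != x2 -> x1 != x2 ->
    i.+2 <= j \/ j.+2 <= i -> ~~ touches i x0 x1 x2 ->
  cross i x0 x1 x2 * cross j (swp i x0) (swp i x1) (swp i x2) =
  cross j x0 x1 x2 * cross i (swp j x0) (swp j x1) (swp j x2).
Proof.
move=> h01 h02 h12 ij no.
have no' : ~~ touches i (swp j x0) (swp j x1) (swp j x2).
  by move: no; rewrite /touches !swp_eq; lia.
have [b01 b02 b12] := untouched_middle h01 h02 h12 no.
have [| | |b01' b02' b12'] := untouched_middle _ _ _ no'; rewrite ?(inj_eq (@swp_inj j)) //.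
have ijn : i != j by lia.
have jin : j != i by lia.
have comm x : swp j (swp i x) = swp i (swp j x).
  by case: ij => ij; rewrite (swp_comm _ ij).
rewrite /cross /lower_half /middle !swp_le // !comm b01 b02 b12 b01' b02' b12'.
by rewrite !mulgV !if_same mulg1 mul1g.
Qed.

(** Two distant exchanges cannot both swap tracked strands, as this would take four; the one that
    does not keeps the relative order and contributes 1. *)
Lemma cross_comm i j x0 x1 x2 : x0 != x1 -> x0 != x2 -> x1 != x2 -> i.+2 <= j ->
  cross i x0 x1 x2 * cross j (swp i x0) (swp i x1) (swp i x2) =
  cross j x0 x1 x2 * cross i (swp j x0) (swp j x1) (swp j x2).
Proof.
move=> h01 h02 h12 ij.
have [ti|ti] := boolP (touches i x0 x1 x2); last first.
  by apply: cross_untouched => //; left.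
have tj : ~~ touches j x0 x1 x2 by move: ti; rewrite /touches; lia.
by apply/esym/cross_untouched => //; right.
Qed.

End CrossComm.

(* Evaluating a braid word on pure braids: the state is the permutation
   performed so far, so that strand k is at position [s k]. *)
Section ThreeStrandMorphism.
Variables (n : nat) (n3 : 2 < n) (H : groupType) (u : nat -> H).

Let strand (k : 'I_3) : 'I_n := widen_ord n3 k.
Let k0 : 'I_n := strand 0%R. Let k1 : 'I_n := strand 1%R. Let k2 : 'I_n := strand 2%:R%R.

Definition state_cross (i : nat) (s : 'S_n) : H := cross u i (s k0) (s k1) (s k2).

(** An inverse letter undoes the positive letter read in the state it leads to; the transposition is
    its own inverse, so both lead from [s] to the same state. *)
Definition letter_cross (l : 'I_n.-1 * bool) (s : 'S_n) : H :=
  if l.2 then (state_cross l.1 (s * adjacent_tperm l.1))^-1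
  else state_cross l.1 s.

Fixpoint word_cross (w : word 'I_n.-1) (s : 'S_n) : H :=
  if w is l :: w' then letter_cross l s * word_cross w' (s * adjacent_tperm l.1)
  else 1.

Lemma word_cross_cat w w' s :
  word_cross (w ++ w') s =
  word_cross w s * word_cross w' (s * word_eval (@adjacent_tperm n) w).
Proof.
elim: w s => [|l w IHw] s /=; first by rewrite /word_eval big_nil mulg1 mul1g.
rewrite IHw mulgA /word_eval big_cons mulgA.
by case: l.2; rewrite // tpermV.
Qed.

Let adjE (s : 'S_n) (i : 'I_n.-1) k :
  (s * adjacent_tperm i) k = swp i (s k) :> nat.
Proof. by rewrite permM adjacent_tpermE. Qed.

Let positions (s : 'S_n) : 
  [/\ s k0 != s k1 :> nat, s k0 != s k2 :> nat & s k1 != s k2 :> nat].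
Proof. by rewrite !val_eqE !(inj_eq perm_inj). Qed.

Lemma word_cross_cong w w' : word_cong (@braid_rel n) w w' ->
  forall s, word_cross w s = word_cross w' s.
Proof.
elim=> {w w'} [w w' ww'|[i b]|//|w w' _ IH|w1 w2 w3 _ IH1 _ IH2|w1 w1' w2 w2' w11 IH1 _ IH2] s.
- have [s01 s02 s12] := positions s.
  case: ww' => i j ij; rewrite /= /letter_cross /state_cross /= !adjE !mulg1.
    case/orP: ij => ij; first exact: cross_comm.
    by apply/esym; apply: cross_comm.
  by rewrite ij !mulgA; apply: cross_braid.
- rewrite /= /letter_cross /= mulg1.
  case: b; rewrite /= ?mulVg // -(mulgA s) tperm2 mulg1; exact: mulgV.
- by rewrite IH.
- by rewrite IH1.
- by rewrite !word_cross_cat IH1 IH2 (word_eval_cong (@adjacent_tperm_rel n) w11).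
Qed.

Definition pure_cross (p : pure_braid n) : H := word_cross (repr (pure_val p)) 1.

Lemma pure_cross_class p w : pure_val p = pres_class (@braid_rel n) w ->
  pure_cross p = word_cross w 1.
Proof. by move=> eq; rewrite /pure_cross eq; apply/word_cross_cong/word_cong_repr. Qed.

(** A pure braid returns the state to 1, which turns the cocycle into a homomorphism. *)
Lemma pure_crossM : {morph pure_cross : p q / p * q}.
Proof.
move=> p q; rewrite (@pure_cross_class _ (repr (pure_val p) ++ repr (pure_val q))).
  rewrite word_cross_cat mul1g; congr (_ * word_cross _ _).
  by have /eqP := pure_valP p.
by rewrite pure_valM.
Qed.

Let gen_val i (lt_i : i < n.-1) : pure_val (pconj (1 : braid n) i) =
  pres_class (@braid_rel n) (word_gen (Ordinal lt_i) ++ word_gen (Ordinal lt_i)).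
Proof. by rewrite pres_classM_group /= mul1g invg1 mulg1 (sgE (Ordinal lt_i)). Qed.

Lemma pure_cross0 : pure_cross (pconj 1 0) = u 0 * (u 1)^-1.
Proof.
have lt0 : 0 < n.-1 by lia.
rewrite (pure_cross_class (gen_val lt0)) /= /letter_cross /state_cross /=.
by rewrite !adjE !perm1 /cross /= mul1g mulg1.
Qed.

Lemma pure_cross1 : pure_cross (pconj 1 1%N) = u 1 * (u 2)^-1.
Proof.
have lt1 : 1 < n.-1 by lia.
rewrite (pure_cross_class (gen_val lt1)) /= /letter_cross /state_cross /=.
by rewrite !adjE !perm1 /cross /= !mulg1.
Qed.

End ThreeStrandMorphism.

(** * Invariant binary quadratic forms *)

Section QuadraticForms.
Local Open Scope ring_scope.

Definition polar (l0 l1 l2 a b a' b' : int) : int :=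
  l0 * a * a' + l1 * (a * b' + b * a') + l2 * b * b'.

(* Unless M is scalar, the form is v |-> det (v, M v). *)
Lemma invariant_form (p q r s : int) : (p * s - q * r) * (p * s - q * r) = 1 ->
  exists l0 l1 l2, ~ [/\ l0 = 0, l1 = 0 & l2 = 0] /\ forall a b a' b',
    (p * s - q * r) * polar l0 l1 l2 (p * a + q * b) (r * a + s * b)
      (p * a' + q * b') (r * a' + s * b') = polar l0 l1 l2 a b a' b'.
Proof.
move=> D1; have [scalar|nscalar] := boolP [&& r == 0, s == p & q == 0].
  (* Here M is 1 or -1, of determinant one, and det(v, Mv) vanishes identically; any form is
     invariant. *)
  exists 1, 0, 0; split=> [[]//|a b a' b'].
  case/and3P: scalar D1 => /eqP-> /eqP-> /eqP-> D1; rewrite /polar.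
  transitivity ((p * p - 0 * 0) * (p * p - 0 * 0) * (a * a')); first by ring.
  by rewrite D1; ring.
(* Twice det(v, Mv), so that the polar coefficient s - p is integral. *)
exists (2 * r), (s - p), (- 2 * q); split=> [[r0 sp q0]|a b a' b'].
  by case/negP: nscalar; apply/and3P; split; apply/eqP; lia.
rewrite /polar.
transitivity ((p * s - q * r) * (p * s - q * r) * polar (2 * r) (s - p) (- 2 * q) a b a' b').
  by rewrite /polar; ring.
by rewrite D1 mul1r.
Qed.

Lemma polar_nondegenerate l0 l1 l2 a b a' b' : a * b' - a' * b != 0 ->
  polar l0 l1 l2 a b a b = 0 -> polar l0 l1 l2 a b a' b' = 0 ->
  polar l0 l1 l2 a' b' a' b' = 0 -> [/\ l0 = 0, l1 = 0 & l2 = 0].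
Proof.
set D := _ - _ => D0 e11 e12 e22.
have cancel x : D * (D * x) = 0 -> x = 0.
  by move/eqP; rewrite !mulf_eq0 (negPf D0) => /eqP.
have comb k11 k12 k22 : k11 * polar l0 l1 l2 a b a b + k12 * polar l0 l1 l2 a b a' b'
    + k22 * polar l0 l1 l2 a' b' a' b' = 0 by rewrite e11 e12 e22 !mulr0 !addr0.
split; apply: cancel.
- by rewrite -(comb (b' * b') (- 2 * b * b') (b * b)) /D /polar; ring.
- by rewrite -(comb (- b' * a') (b' * a + b * a') (- a * b)) /D /polar; ring.
- by rewrite -(comb (a' * a') (- 2 * a * a') (a * a)) /D /polar; ring.
Qed.

Lemma int_inverse_square (d e : int) : d * e = 1 -> d * d = 1.
Proof.
move=> de; have /eqP := congr1 absz de; rewrite abszM muln_eq1 => /andP[/eqP d1 _].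
by have [->|->] : d = 1 \/ d = - 1 by lia.
Qed.

End QuadraticForms.

(** * Pulling the functionals back along homomorphisms to the free group *)

Section MorphismsToFree.
Variables (G : groupType).
Local Open Scope ring_scope.

Definition is_morph (F : G -> free2) := {morph F : x y / (x * y)%g}.

Lemma morphR (F : G -> free2) : is_morph F -> {morph F : x y / [~ x, y]%g}.
Proof.
move=> FM x y; have F1 : F 1%g = 1%g.
  by apply: (mulgI (F 1%g)); rewrite -FM !mulg1.
have FV z : F (z^-1)%g = ((F z)^-1)%g.
  by apply: (mulgI (F z)); rewrite -FM !mulgV.
by rewrite /commg /conjg !FM !FV.
Qed.

Lemma morph_expaM F : is_morph F -> forall x y, expa (F (x * y)%g) = expa (F x) + expa (F y).
Proof. by move=> FM x y; rewrite FM expaM. Qed.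

Lemma morph_expbM F : is_morph F -> forall x y, expb (F (x * y)%g) = expb (F x) + expb (F y).
Proof. by move=> FM x y; rewrite FM expbM. Qed.

(* Commuting elements span an isotropic plane: [area] is a Heisenberg cocycle. *)
Lemma morph_commute F : is_morph F -> forall x y, (x * y = y * x)%g ->
  expa (F x) * expb (F y) = expa (F y) * expb (F x).
Proof.
move=> FM x y xy; have := congr1 (fun z => area (F z)) xy.
by rewrite /= !FM !areaM [area (F y) + _]addrC => /addrI.
Qed.

(** 6 = (-2)(-3) comes from the two outer commutators; the innermost one contributes the
    determinant. *)
Lemma quadratic_commutator F l0 l1 l2 (g1 g2 h h' : G) : is_morph F ->
  quadratic l0 l1 l2 (F [~ [~ [~ g1, g2], h], h']%g) =
  6 * (expa (F g1) * expb (F g2) - expa (F g2) * expb (F g1)) *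
  polar l0 l1 l2 (expa (F h)) (expb (F h)) (expa (F h')) (expb (F h')).
Proof.
move=> FM; rewrite !(morphR FM).
have k1 : lcs 1 [~ F g1, F g2]%g by apply: lcsR.
have k2 : lcs 2 [~ [~ F g1, F g2], F h]%g by apply: lcsR.
rewrite quadraticR //; have [-> ->] := momentR (F h) k1.
by rewrite areaR /polar; ring.
Qed.

(** Climbs by weight: the area scales by D = det M, the moments transform by D M, and the quadratic
    functional acquires D times the transformed form. *)
Lemma quadratic_invariant F F' l0 l1 l2 (p q r s : int) : is_morph F -> is_morph F' ->
    (forall x, expa (F' x) = p * expa (F x) + q * expb (F x)) ->
    (forall x, expb (F' x) = r * expa (F x) + s * expb (F x)) ->
    (forall a b a' b', (p * s - q * r) * polar l0 l1 l2 (p * a + q * b) (r * a + s * b)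
      (p * a' + q * b') (r * a' + s * b') = polar l0 l1 l2 a b a' b') ->
  forall x, lcs 3 x -> quadratic l0 l1 l2 (F' x) = quadratic l0 l1 l2 (F x).
Proof.
move=> FM F'M ea eb inv; set D := p * s - q * r in inv.
have pull (E : G -> free2) (f : free2 -> int) k : is_morph E -> (1 <= k)%N ->
    additive_on (lcs 1) f -> additive_on (lcs k) (fun x => f (E x)).
  move=> EM k1 fD x y kx ky; rewrite EM fD //.
    exact: lcs_morph EM (lcs_le k1 kx).
  exact: lcs_morph EM (lcs_le k1 ky).
have [aD bD] := moment_lcs1.
have areaE x : lcs 1 x -> area (F' x) = D * area (F x).
  move: x; apply: lcs_additive_eq => [||x y _]; first exact: pull area_lcs1.
    by move=> x y kx ky; rewrite (pull F area 1%N) //; [rewrite mulrDr | exact: area_lcs1].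
  by rewrite !(morphR FM) !(morphR F'M) !areaR !ea !eb /D; ring.
have aE x : lcs 2 x -> momenta (F' x) = D * (p * momenta (F x) + q * momentb (F x)).
  move: x; apply: lcs_additive_eq => [||x y kx]; first exact: pull aD.
    by move=> x y kx ky; rewrite (pull F momenta 2%N) // (pull F momentb 2%N) //; ring.
  rewrite !(morphR FM) !(morphR F'M).
  have [-> _] := momentR (F' y) (lcs_morph F'M kx).
  have [-> ->] := momentR (F y) (lcs_morph FM kx).
  by rewrite (areaE x kx) ea; ring.
have bE x : lcs 2 x -> momentb (F' x) = D * (r * momenta (F x) + s * momentb (F x)).
  move: x; apply: lcs_additive_eq => [||x y kx]; first exact: pull bD.
    by move=> x y kx ky; rewrite (pull F momenta 2%N) // (pull F momentb 2%N) //; ring.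
  rewrite !(morphR FM) !(morphR F'M).
  have [_ ->] := momentR (F' y) (lcs_morph F'M kx).
  have [-> ->] := momentR (F y) (lcs_morph FM kx).
  by rewrite (areaE x kx) eb; ring.
apply: lcs_additive_eq => [||x y kx].
- exact: pull (quadratic_lcs1 _ _ _).
- exact: pull (quadratic_lcs1 _ _ _).
- rewrite !(morphR FM) !(morphR F'M) !quadraticR; try exact: lcs_morph.
  rewrite aE // bE // ea eb.
  have := inv (expa (F y)) (expb (F y)) (momenta (F x)) (momentb (F x)).
  rewrite /polar => eq.
  transitivity (- 3 * polar l0 l1 l2 (expa (F y)) (expb (F y))
    (momenta (F x)) (momentb (F x))); rewrite /polar -?eq; ring.
Qed.

End MorphismsToFree.

(** * Planes attached to homomorphisms of the pure braid group *)

Section TwistSystems.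
Variable n : nat.
Local Notation G := (pure_braid n).
Local Open Scope ring_scope.

Implicit Types F : G -> free2.

Definition va F (x y : 'I_n) : int := expa (F (twist x y)).
Definition vb F (x y : 'I_n) : int := expb (F (twist x y)).
Definition det F := triangle_det (va F) (vb F).
Definition eps F := star_bit (va F) (vb F).

Definition exp_surjective F := exists g1 g2,
  [/\ expa (F g1) = 1, expb (F g1) = 0, expa (F g2) = 0 & expb (F g2) = 1].

Definition proportional F F' := exists L m11 m12 m21 m22 : int, L != 0 /\
  forall g, L * expa (F' g) = m11 * expa (F g) + m12 * expb (F g) /\
            L * expb (F' g) = m21 * expa (F g) + m22 * expb (F g).

Lemma twist_isotropic_system F : is_morph F -> isotropic_system (va F) (vb F).
Proof.
move=> FM; have aM := morph_expaM FM; have bM := morph_expbM FM.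
have cM := morph_commute FM.
split=> [a b|a b|a b c d|a b c].
- exact: (additive_twistC aM).
- exact: (additive_twistC bM).
- exact: (twist_disjoint aM bM cM).
- exact: (twist_triangle aM bM cM).
Qed.

Lemma isotropic_system_swap (T : eqType) (v u : T -> T -> int) :
  isotropic_system v u -> isotropic_system u v.
Proof.
case=> sv su dj tr; split=> // [a b c d abcd|a b c abc].
  by rewrite mulrC -dj // mulrC.
by rewrite mulrC -tr // mulrC.
Qed.

(** Otherwise all twists have parallel vectors; additivity in each argument in turn spreads this to
    all elements, against surjectivity. *)
Lemma nondegenerate F : is_morph F -> exp_surjective F ->
  exists a b c, uniq [:: a; b; c] /\ det F a b c != 0.
Proof.
move=> FM [g1 [g2 [a1 b1 a2 b2]]]; apply: contrapT => none.
have vuA := twist_isotropic_system FM.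
have det0 a b c : uniq [:: a; b; c] -> triangle_det (va F) (vb F) a b c = 0.
  move=> abc; apply/eqP/negPn/negP => D0; apply: none.
  by exists a, b, c.
have par := iso_degenerate vuA det0.
have par1 g c d : c != d -> expa (F g) * vb F c d - va F c d * expb (F g) = 0.
  move=> cd; pose w g := expa (F g) * vb F c d - va F c d * expb (F g).
  apply: (additive_eq0 (v := w)) => [x y|a b ab]; rewrite /w.
    by rewrite (morph_expaM FM) (morph_expbM FM); ring.
  by apply/eqP; rewrite subr_eq0; apply/eqP/par.
have : expa (F g1) * expb (F g2) - expa (F g2) * expb (F g1) = 0.
  pose w g := expa (F g1) * expb (F g) - expa (F g) * expb (F g1).
  apply: (additive_eq0 (v := w)) => [x y|a b ab]; rewrite /w.
    by rewrite (morph_expaM FM) (morph_expbM FM); ring.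
  exact: par1.
by rewrite a1 b1 a2 b2.
Qed.

(** [iso_same_type] expresses only the first coordinate of the second plane; swapping its
    coordinates gives the other. [additive_eq0] then extends both identities from twists to the
    group. *)
Lemma same_type_proportional F F' (a b c : 'I_n) : is_morph F -> is_morph F' ->
    uniq [:: a; b; c] -> det F a b c != 0 -> det F' a b c != 0 ->
    (forall d, d \notin [:: a; b; c] -> eps F a d = eps F' a d) ->
  proportional F F'.
Proof.
move=> FM F'M abc D0 D0' same.
have A := twist_isotropic_system FM; have A' := twist_isotropic_system F'M.
have D0'' : triangle_det (vb F') (va F') a b c != 0.
  by move: D0'; rewrite -oppr_eq0 /det /triangle_det; congr (_ != 0); ring.
have same' d : d \notin [:: a; b; c] -> eps F a d = star_bit (vb F') (va F') a d.
  by move=> dabc; rewrite same // /eps /star_bit orbC.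
have Ea := iso_same_type A A' abc D0 D0' same.
have Eb := iso_same_type A (isotropic_system_swap A') abc D0 D0'' same'.
set v := va F in Ea Eb; set u := vb F in Ea Eb.
pose coef1 (w : 'I_n -> 'I_n -> int) := u a c * w a b - u a b * w a c.
pose coef2 (w : 'I_n -> 'I_n -> int) := v a b * w a c - v a c * w a b.
exists (det F a b c), (coef1 (va F')), (coef2 (va F')), (coef1 (vb F')), (coef2 (vb F')).
split=> // g; split; apply/eqP; rewrite -subr_eq0; apply/eqP.
- apply: (additive_eq0 (v := fun g => det F a b c * expa (F' g) -
    (coef1 (va F') * expa (F g) + coef2 (va F') * expb (F g)))) => [x y|x y xy].
    by rewrite (morph_expaM FM) (morph_expbM FM) (morph_expaM F'M); ring.
  rewrite -/(va F' x y) -/(va F x y) -/(vb F x y) [_ * va F' x y]Ea //.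
  by rewrite /coef1 /coef2 /v /u; ring.
- apply: (additive_eq0 (v := fun g => det F a b c * expb (F' g) -
    (coef1 (vb F') * expa (F g) + coef2 (vb F') * expb (F g)))) => [x y|x y xy].
    by rewrite (morph_expaM FM) (morph_expbM FM) (morph_expbM F'M); ring.
  rewrite -/(vb F' x y) -/(va F x y) -/(vb F x y) [_ * vb F' x y]Eb //.
  by rewrite /coef1 /coef2 /v /u; ring.
Qed.

(** Preimages of the basis vectors under [F] make the matrix integral; preimages under [F'] show
    that its determinant divides 1. *)
Lemma proportional_integral F F' : exp_surjective F -> exp_surjective F' ->
    proportional F F' ->
  exists p q r s : int, (p * s - q * r) * (p * s - q * r) = 1 /\
    forall g, expa (F' g) = p * expa (F g) + q * expb (F g) /\
              expb (F' g) = r * expa (F g) + s * expb (F g).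
Proof.
move=> [g1 [g2 [a1 b1 a2 b2]]] [h1 [h2 [c1 d1 c2 d2]]].
move=> [L [m11 [m12 [m21 [m22 [L0 E]]]]]].
have E' g : expa (F' g) = expa (F' g1) * expa (F g) + expa (F' g2) * expb (F g) /\
            expb (F' g) = expb (F' g1) * expa (F g) + expb (F' g2) * expb (F g).
  have [e1 f1] := E g1; have [e2 f2] := E g2; have [e f] := E g.
  rewrite a1 b1 mulr1 mulr0 addr0 in e1 f1; rewrite a2 b2 mulr1 mulr0 add0r in e2 f2.
  split; apply: (mulfI L0).
    by rewrite mulrDr !mulrA e e1 e2.
  by rewrite mulrDr !mulrA f f1 f2 !mulr1 !mulr0 addr0 add0r.
set p := expa (F' g1) in E'; set q := expa (F' g2) in E'.
set r := expb (F' g1) in E'; set s := expb (F' g2) in E'.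
exists p, q, r, s; split=> //.
have [e1 f1] := E' h1; have [e2 f2] := E' h2.
apply: (@int_inverse_square _
  (expa (F h1) * expb (F h2) - expa (F h2) * expb (F h1))).
transitivity (expa (F' h1) * expb (F' h2) - expa (F' h2) * expb (F' h1)).
  by rewrite e1 f1 e2 f2; ring.
by rewrite c1 c2 d1 d2.
Qed.

End TwistSystems.

(** * The orbit sum and the conclusion *)

Section Main.
Variables (n : nat) (n3 : (2 < n)%N).
Local Notation G := (pure_braid n).
Variable alpha : G -> G.
Hypotheses (alphaM : {morph alpha : x y / (x * y)%g}) (alpha_bij : bijective alpha).
Local Open Scope ring_scope.

(** The values a, 1, b^-1 send sigma_0^2 to a 1^-1 = a and sigma_1^2 to 1 (b^-1)^-1 = b. *)
Let base_gen (k : nat) : free2 :=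
  if k is 0 then free2_gen true else if k is 1%N then 1%g else ((free2_gen false)^-1)%g.

Let f : G -> free2 := pure_cross n3 base_gen.
Let F (i : nat) (g : G) : free2 := f (iter i alpha g).

Let iterM i : {morph iter i alpha : x y / (x * y)%g}.
Proof. by elim: i => [|i IHi] x y //=; rewrite IHi alphaM. Qed.

Let FM i : is_morph (F i).
Proof. by move=> x y; rewrite /F iterM; apply: pure_crossM. Qed.

Let iter_surj i g : exists h, iter i alpha h = g.
Proof.
have [beta _ betaK] := alpha_bij; elim: i g => [|i IHi] g; first by exists g.
by have [h hE] := IHi (beta g); exists h; rewrite /= hE betaK.
Qed.

Let FD i j g : F (i + j) g = F i (iter j alpha g).
Proof. by rewrite /F iterD. Qed.

Let F_surj i : exp_surjective (F i).
Proof.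
have [g1 g1E] := iter_surj i (pconj 1 0).
have [g2 g2E] := iter_surj i (pconj 1 1%N).
exists g1, g2; rewrite /F g1E g2E /f pure_cross0 pure_cross1 /=.
by rewrite invg1 mulg1 invgK mul1g !expa_gen !expb_gen.
Qed.

Let proportional_shift i j k : proportional (F (i + k)) (F (j + k)) <->
  proportional (F i) (F j).
Proof.
split=> -[L [m11 [m12 [m21 [m22 [L0 E]]]]]]; exists L, m11, m12, m21, m22; split=> // g.
  have [h <-] := iter_surj k g; by move: (E h); rewrite !FD.
by rewrite !FD; apply: E.
Qed.

(* By the pigeonhole principle on the finitely many combinatorial types. *)
Let exists_period : exists k, (0 < k)%N /\ proportional (F 0) (F k).
Proof.
have base i : {t : 'I_n * 'I_n * 'I_n |
    uniq [:: t.1.1; t.1.2; t.2] /\ det (F i) t.1.1 t.1.2 t.2 != 0}.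
  apply: cid; have [a [b [c abc]]] := nondegenerate (FM i) (F_surj i).
  by exists (a, b, c).
pose code i : 'I_n * 'I_n * 'I_n * {ffun 'I_n -> bool} :=
  (sval (base i), [ffun d => eps (F i) (sval (base i)).1.1 d]).
have [i [j [ij eq_code]]] : exists i j, (i < j)%N /\ code i = code j.
  apply: contrapT => none.
  pose h (m : 'I_(#|{: 'I_n * 'I_n * 'I_n * {ffun 'I_n -> bool}}|.+1)) := code m.
  suff h_inj : injective h by have := leq_card _ h_inj; rewrite card_ord ltnn.
  move=> x y xy; apply: val_inj; case: (ltngtP x y) => // lt; case: none.
    by exists x, y.
  by exists y, x.
case: eq_code => eq_base eq_eps.
exists (j - i)%N; split; first by rewrite subn_gt0.
rewrite -(proportional_shift 0 (j - i) i) add0n subnK; last exact: ltnW.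
have [abc D0] := svalP (base i); have [_ D0'] := svalP (base j).
rewrite -eq_base in D0' eq_eps.
apply: (same_type_proportional (FM i) (FM j) abc D0 D0') => d _.
by have /ffunP/(_ d) := eq_eps; rewrite !ffunE.
Qed.

Let quad i := exists a b c d, [/\ uniq [:: a; b; c], d \notin [:: a; b; c],
  det (F i) a b c != 0 & eps (F i) a d].

(* If some plane is of four-strand type, it is taken as base plane, and h1, h2
   involve its fourth strand; otherwise all planes are of three-strand type. *)
Let separating_elements k : (0 < k)%N ->
    (forall j, (0 < j < k)%N -> ~ proportional (F 0) (F j)) ->
  exists i0 (a b c : 'I_n) (h1 h2 : G), [/\ det (F i0) a b c != 0,
    expa (F i0 h1) * expb (F i0 h2) - expa (F i0 h2) * expb (F i0 h1) != 0 &
    forall j, (0 < j < k)%N -> det (F (j + i0)) a b c != 0 ->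
      [/\ expa (F (j + i0) h1) = 0, expb (F (j + i0) h1) = 0,
         expa (F (j + i0) h2) = 0 & expb (F (j + i0) h2) = 0]].
Proof.
move=> k0 kmin.
have nprop i0 j : (0 < j < k)%N -> ~ proportional (F i0) (F (j + i0)).
  by move=> /kmin nj; rewrite -[i0 in F i0]add0n => /proportional_shift.
have [[i0 [a [b [c [d [abc dabc D0 ed]]]]]]|noquad] := pselect (exists i, quad i).
  have A := twist_isotropic_system (FM i0).
  exists i0, a, b, c, (twist a d), (twist b d); split=> // [|j jk Dj].
    have [[va_ad vb_ad va_bd vb_bd] _] := iso_star A abc D0 dabc.
    have [va_bc vb_bc] := iso_triangle_sum A abc D0.
    rewrite -!/(va _ _ _) -!/(vb _ _ _) va_ad vb_ad va_bd vb_bd.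
    rewrite [star_bit _ _ _ _]ed /= !mulr1n va_bc vb_bc.
    rewrite -oppr_eq0 in D0; move: D0; congr (_ != 0).
    by rewrite /det /triangle_det; ring.
  have Aj := twist_isotropic_system (FM (j + i0)).
  have [[va_ad vb_ad va_bd vb_bd] _] := iso_star Aj abc Dj dabc.
  rewrite -!/(va _ _ _) -!/(vb _ _ _) va_ad vb_ad va_bd vb_bd.
  case edj : (star_bit _ _ _ _); last by rewrite !mulr0n.
  case: (nprop i0 j jk); apply: (same_type_proportional (FM i0) (FM _) abc D0 Dj).
  move=> d' d'abc; apply/idP/idP => ed'.
    by rewrite -(star_bit_unique A abc D0 dabc d'abc ed ed') /eps edj.
  by rewrite -(star_bit_unique Aj abc Dj dabc d'abc edj ed').
have [a [b [c [abc D0]]]] := nondegenerate (FM 0) (F_surj 0).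
exists 0%N, a, b, c, (twist a b), (twist a c); split=> // j jk Dj.
case: (nprop 0%N j jk).
apply: (same_type_proportional (FM 0) (FM _) abc D0 Dj) => d dabc.
transitivity false; last apply/esym; apply/negP => ed; apply: noquad.
  by exists 0%N, a, b, c, d.
by exists (j + 0)%N, a, b, c, d.
Qed.

Lemma pure_braid_Reidemeister : reidemeister_number alpha = +oo%E.
Proof.
(* The least period is taken, so that no plane strictly in between is proportional to the first. *)
have [k [[k0 Fk] kmin]] : exists k, ((0 < k)%N /\ proportional (F 0) (F k)) /\
    forall j, (0 < j < k)%N -> ~ proportional (F 0) (F j).
  have exP : exists k, `[< (0 < k)%N /\ proportional (F 0) (F k) >].
    by have [k Pk] := exists_period; exists k; apply/asboolP.
  case: (ex_minnP exP) => k /asboolP Pk kmin; exists k; split=> // j /andP[j0 jk] Pj.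
  by have := kmin j (introT (asboolP _) (conj j0 Pj)); rewrite leqNgt jk.
have [i0 [a [b [c [h1 [h2 [D0 h12 sep]]]]]]] := separating_elements k0 kmin.
have Fk0 : proportional (F i0) (F (k + i0)).
  by rewrite -[i0 in F i0]add0n; apply/proportional_shift.
have [p [q [r [s [detM E]]]]] := proportional_integral (F_surj _) (F_surj _) Fk0.
have [l0 [l1 [l2 [l_neq0 inv]]]] := invariant_form detM.
pose psi i (x : G) : rat := (quadratic l0 l1 l2 (F i x))%:~R.
have psiD i : additive_on (lcs 1) (psi i).
  move=> x y kx ky; rewrite /psi (FM i) quadratic_lcs1 ?intrD //.
    exact: (lcs_morph (FM i) kx).
  exact: (lcs_morph (FM i) ky).
pose phi x := \sum_(i < k) psi (i + i0)%N x.
have psi_period x : lcs 3 x -> psi (k + i0)%N x = psi i0 x.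
  move=> kx; congr (_%:~R).
  exact: (quadratic_invariant (FM i0) (FM _) (fun g => (E g).1)
    (fun g => (E g).2) inv kx).
have psi_alpha i x : psi i (alpha x) = psi i.+1 x.
  by rewrite /psi -addn1 FD.
apply: (@invariant_functional_Reidemeister _ alpha (pure_braid_fin_gen n) alphaM 3 phi).
split=> [x y kx ky|x kx|x kx|].
- rewrite /phi -big_split; apply: eq_bigr => i _.
  by apply: psiD; apply: (@lcs_le _ 1 3).
- rewrite /phi big1 // => i _; rewrite /psi quadratic_lcs4 //.
  exact: (lcs_morph (FM _) kx).
(* [alpha] shifts the orbit by one, and periodicity returns the last term to the first. *)
- rewrite /phi; under eq_bigr => i _ do rewrite psi_alpha.
  case: (k) k0 psi_period => // m _ period.
  by rewrite big_ord_recr [RHS]big_ord_recl /= addrC -addSn period.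
(* A nonzero form cannot vanish on all pairs from [h1], [h2], whose vectors are independent. *)
have [h [h' [hh lam]]] : exists h h', [/\ (h = h1 \/ h = h2) & polar l0 l1 l2
    (expa (F i0 h)) (expb (F i0 h)) (expa (F i0 h')) (expb (F i0 h')) != 0].
  apply: contrapT => none; apply: l_neq0.
  apply: (polar_nondegenerate h12); apply/eqP/negPn/negP => lam; apply: none.
  - by exists h1, h1; split=> //; left.
  - by exists h1, h2; split=> //; left.
  - by exists h2, h2; split=> //; right.
exists [~ [~ [~ twist a b, twist a c], h], h']%g; first by do 3!apply: lcsR.
rewrite /phi (bigD1 (Ordinal k0)) //= big1 ?addr0 => [|i i_neq0].
  rewrite /psi (quadratic_commutator _ _ _ _ _ _ _ (FM i0)) intr_eq0.
  rewrite mulf_neq0 // mulf_neq0 //.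
(* On every other plane of the orbit, either the determinant at a, b, c vanishes and kills the
   innermost commutator, or [sep] kills [h]. *)
rewrite /psi (quadratic_commutator _ _ _ _ _ _ _ (FM _)).
have ik : (0 < i < k)%N.
  rewrite ltn_ord andbT lt0n; apply: contra i_neq0 => /eqP i0'.
  by apply/eqP/val_inj.
have [D0i|Di] := eqVneq (det (F (i + i0)) a b c) 0.
  move: D0i; rewrite /det /triangle_det /va /vb => ->.
  by rewrite mulr0 mul0r.
have [e1 e2 e3 e4] := sep i ik Di.
by case: hh => ->; rewrite /polar ?e1 ?e2 ?e3 ?e4 ?mulr0 ?mul0r ?addr0 ?mulr0.
Qed.

End Main.

Theorem theorem12 (n : nat) (hn : 3 <= n) : has_R_infty (pure_braid n).
Proof.
by move=> alpha; apply: pure_braid_Reidemeister hn _ _; apply: gmulfM.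
Qed.
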